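(* Let $\Bbbk$ be a field. The bialgebra $(H,\mu,\Delta^d,\eta,\epsilon^d_\Delta)$ is a comodule bialgebra over the bialgebra $(H^d,\mu,\delta^d,\eta,\varepsilon^d_\delta)$ via $\delta^d:H\to H^d\otimes H$. As a consequence, $(H^d,\mu,\Delta^d,\delta^d)$ is a double bialgebra.
   Context: A hypergraph $(E,V)$ is a map of sets $h:E\to P(V)$, with $P(V)$ the power set of $V$; elements of $E$ are edges, elements of $V$ are vertices. No restriction is put on $h$: edges may be empty, distinct edges may have the same vertex set. $H$ is the $\Bbbk$-vector space with basis the isomorphism classes of hypergraphs with $E$ and $V$ finite. Product $\mu$ on $H$: disjoint union, with unit $\eta:1\mapsto(\emptyset,\emptyset)$. Dual coproduct $\Delta^d$: for $F\subseteq E$ let $V_{|F}$ be the set of vertices $v$ all of whose incident edges are in $F$, and $F^c=E\setminus F$. Then $\Delta^d(E,V)=\sum_{F\subseteq E}(F,V_{|F})\otimes(F^c,V_{|F^c})$, with counit $\epsilon^d_\Delta(E,V)=1$ if $E=\emptyset$ and $0$ otherwise. (Here each edge $f\in F$ of $(F,V_{|F})$ has vertex set $h(f)\cap V_{|F}$; similarly for $F^c$.) $V^*\subseteq V$ is the set of vertices incident to at least one edge. $H^d\subseteq H$ is the subspace spanned by hypergraphs with $V=V^*$ (every vertex lies on at least one edge); it is closed under $\mu$ and $\Delta^d$. For $U\subseteq V^*$: $(E,U)$ is the hypergraph with edges $E$ and vertex sets $h(e)\cap U$. $E/U$ is the quotient of $E$ by the equivalence relation generated by $e\sim e'$ if $e$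 and $e'$ share a common vertex in $U$ (edges with no vertex in $U$ form singleton classes). With $U^c=V\setminus U$, $(E/U,U^c)$ is the hypergraph in which a vertex $v\in U^c$ belongs to a class in $E/U$ iff $v$ belongs to some edge in that class. Define $$\delta^d:H\to H^d\otimes H,\qquad (E,V)\mapsto\sum_{U\subseteq V^*}(E,U)\otimes(E/U,U^c).$$ It restricts to a coproduct on $H^d$ (also denoted $\delta^d$), with counit $\varepsilon^d_\delta(E,V)=1$ if $V=\emptyset$ and $0$ otherwise. Comodule bialgebra: a bialgebra $(A,\mu_A,\Delta_A,\eta_A,\epsilon_A)$ is a comodule bialgebra over a bialgebra $(B,\mu_B,\delta_B,\eta_B,\epsilon_B)$ via $\delta:A\to B\otimes A$ if $\delta$ makes $A$ a left $B$-comodule and, with $m_{13,2,4}(b\otimes a\otimes b'\otimes a')=bb'\otimes a\otimes a'$: 1) $(\mathrm{id}_B\otimes\epsilon_A)\circ\delta=\eta_B\circ\epsilon_A$; 2) $(\mathrm{id}_B\otimes\Delta_A)\circ\delta=m_{13,2,4}\circ(\delta\otimes\delta)\circ\Delta_A$; 3) $\delta(1_A)=1_B\otimes 1_A$; 4) $\delta\circ\mu_A=(\mathrm{id}_B\otimes\mu_A)\circ m_{13,2,4}\circ(\delta\otimes\delta)$. Double bialgebra: $(B,\mu,\Delta,\delta)$ such that $(B,\mu,\Delta)$ and $(B,\mu,\delta)$ are bialgebras (same product and unit, each coproduct with its own counit) and $(B,\mu,\Delta)$ is a comodule bialgebra over $(B,\mu,\delta)$ via $\delta$. *)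

(* Defs.v *)
From HB Require Import structures.
From mathcomp Require Import all_boot all_algebra.
From mathcomp Require Export finmap multinomials.monalg.

Set Implicit Arguments.
Unset Strict Implicit.
Unset Printing Implicit Defensive.

Import GRing.Theory.
Local Open Scope ring_scope.
Local Open Scope quotient_scope.

(* All the spaces involved have a given basis: [{malg k[I]}] is the k-vector
   space with basis I, and [{malg k[(I * J)%type]}], with [tens], is the tensor
   product of [{malg k[I]}] and [{malg k[J]}] (see [tens_universal]). *)

(* [<< i >>], locked to keep unification from unfolding it *)
HB.lock Definition basis {k : fieldType} {I : choiceType} (i : I) :
  {malg k[I]} := << i >>.
Canonical basis_unlockable := Unlockable basis.unlock.

HB.lock Definition lext {k : fieldType} {I : choiceType} {M : lmodType k}
    (f : I -> M) (x : {malg k[I]}) : M :=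
  \sum_(i <- msupp x) x@_i *: f i.
Canonical lext_unlockable := Unlockable lext.unlock.

Section FreeSpaces.
Context {k : fieldType}.

Lemma lextE (I : choiceType) (M : lmodType k) (f : I -> M) (x : {malg k[I]}) :
  lext f x = \sum_(i <- msupp x) x@_i *: f i.
Proof. by rewrite unlock. Qed.

Lemma lextEw (I : choiceType) (M : lmodType k) (f : I -> M) (x : {malg k[I]})
    (d : {fset I}) : {subset msupp x <= d} ->
  lext f x = \sum_(i <- d) x@_i *: f i.
Proof.
move=> sxd; have {}sxd : (msupp x `<=` d)%fset by apply/fsubsetP.
rewrite lextE; apply: big_fset_incl => // i _.
by move=> /mcoeff_outdom ->; rewrite scale0r.
Qed.

Lemma lext_is_linear (I : choiceType) (M : lmodType k) (f : I -> M) :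
  linear (lext f).
Proof.
move=> a x y; set d := (msupp x `|` msupp y `|` msupp (a *: x + y))%fset.
rewrite !(@lextEw _ _ _ _ d); try by move=> i ix; rewrite !inE ix ?orbT.
rewrite scaler_sumr -big_split /=; apply: eq_bigr => i _.
by rewrite mcoeffD mcoeffZ scalerDl scalerA.
Qed.

HB.instance Definition _ (I : choiceType) (M : lmodType k) (f : I -> M) :=
  GRing.isLinear.Build k {malg k[I]} M *:%R (lext f) (lext_is_linear f).

Lemma lextU (I : choiceType) (M : lmodType k) (f : I -> M) (i : I) :
  lext f (basis i) = f i.
Proof.
rewrite basis.unlock (@lextEw _ _ _ _ [fset i]%fset);
  first by rewrite big_seq_fset1 mcoeffUU scale1r.
by move=> j; rewrite msuppU oner_eq0.
Qed.

Lemma malg_lext (I : choiceType) (x : {malg k[I]}) :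
  x = lext (fun i => basis i) x.
Proof.
rewrite {1}[x]monalgE lextE; apply: eq_bigr => i _.
rewrite basis.unlock; apply/malgP => j.
by rewrite mcoeffZ !mcoeffU mulr_natr.
Qed.

Lemma lin_ext (I : choiceType) (M : lmodType k)
    (f g : {linear {malg k[I]} -> M}) :
  (forall i, f (basis i) = g (basis i)) -> f =1 g.
Proof.
move=> fg x; rewrite [x]malg_lext lextE !linear_sum /=.
by apply: eq_bigr => i _; rewrite !linearZ /= fg.
Qed.

Definition tens {I J : choiceType} (x : {malg k[I]}) (y : {malg k[J]}) :
    {malg k[(I * J)%type]} :=
  lext (fun i => lext (fun j => basis (i, j)) y) x.

Lemma tensUU (I J : choiceType) (i : I) (j : J) :
  tens (basis i) (basis j) = basis (i, j).
Proof. by rewrite /tens !lextU. Qed.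

Lemma tens_linearl (I J : choiceType) (y : {malg k[J]}) :
  linear (fun x : {malg k[I]} => tens x y).
Proof. exact: linearP. Qed.

Lemma tens_linearr (I J : choiceType) (x : {malg k[I]}) :
  linear (fun y : {malg k[J]} => tens x y).
Proof.
move=> a y z; rewrite /tens !(lextE _ x) scaler_sumr -big_split /=.
apply: eq_bigr => i _; rewrite linearP.
by rewrite scalerDr !scalerA mulrC.
Qed.

Lemma tens_universal (I J : choiceType) (M : lmodType k)
    (b : {malg k[I]} -> {malg k[J]} -> M) :
    (forall y, linear (b^~ y)) -> (forall x, linear (b x)) ->
  exists f : {linear {malg k[(I * J)%type]} -> M},
    (forall x y, f (tens x y) = b x y) /\
    (forall g : {linear {malg k[(I * J)%type]} -> M},
       (forall x y, g (tens x y) = b x y) -> g =1 f).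
Proof.
move=> bl br.
exists (lext (fun p : I * J => b (basis p.1) (basis p.2))); split=> [x y|g gb].
  pose bly y0 : {linear _ -> _} :=
    HB.pack (b^~ y0) (GRing.isLinear.Build _ _ _ _ _ (bl y0)).
  pose brx x0 : {linear _ -> _} :=
    HB.pack (b x0) (GRing.isLinear.Build _ _ _ _ _ (br x0)).
  pose tl : {linear {malg k[I]} -> {malg k[(I * J)%type]}} := HB.pack (fun z => tens z y)
    (GRing.isLinear.Build _ _ _ _ _ (@tens_linearl I J y)).
  pose L := lext (fun p : I * J => b (basis p.1) (basis p.2)).
  apply: (@lin_ext _ _ (L \o tl) (bly y)) => i /=.
  pose tr : {linear {malg k[J]} -> {malg k[(I * J)%type]}} := HB.pack (tens (basis i))
    (GRing.isLinear.Build _ _ _ _ _ (@tens_linearr I J (basis i))).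
  apply: (@lin_ext _ _ (L \o tr) (brx (basis i))) => j /=.
  by rewrite /L tensUU lextU.
by apply: lin_ext => -[i j]; rewrite /= lextU -tensUU gb.
Qed.

(* f (x) g *)
Definition tmap {I J I' J' : choiceType}
    (f : {malg k[I]} -> {malg k[I']}) (g : {malg k[J]} -> {malg k[J']}) :
    {malg k[(I * J)%type]} -> {malg k[(I' * J')%type]} :=
  lext (fun p => tens (f (basis p.1)) (g (basis p.2))).

Lemma tmapU (I J I' J' : choiceType) (f : {malg k[I]} -> {malg k[I']})
    (g : {malg k[J]} -> {malg k[J']}) i j :
  tmap f g (basis (i, j)) = tens (f (basis i)) (g (basis j)).
Proof. by rewrite /tmap lextU. Qed.

Lemma tmap_is_linear (I J I' J' : choiceType) (f : {malg k[I]} -> {malg k[I']})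
    (g : {malg k[J]} -> {malg k[J']}) : linear (tmap f g).
Proof. exact: linearP. Qed.

HB.instance Definition _ (I J I' J' : choiceType)
    (f : {malg k[I]} -> {malg k[I']}) (g : {malg k[J]} -> {malg k[J']}) :=
  GRing.isLinear.Build k _ _ _ (tmap f g) (tmap_is_linear f g).

(* id (x) e and e (x) id for a linear form e, with A (x) k and k (x) A
   identified with A *)
Definition tformr {I J : choiceType} (e : {malg k[J]} -> k) :
    {malg k[(I * J)%type]} -> {malg k[I]} :=
  lext (fun p => e (basis p.2) *: basis p.1).

Definition tforml {I J : choiceType} (e : {malg k[I]} -> k) :
    {malg k[(I * J)%type]} -> {malg k[J]} :=
  lext (fun p => e (basis p.1) *: basis p.2).

Definition tassoc {I J L : choiceType} :
    {malg k[((I * J) * L)%type]} -> {malg k[(I * (J * L))%type]} :=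
  lext (fun p => basis (p.1.1, (p.1.2, p.2))).

(* (a (x) b) (x) (c (x) d) |-> (a (x) c) (x) (b (x) d) *)
Definition tmid {I J I' J' : choiceType} :
    {malg k[((I * J) * (I' * J'))%type]} -> {malg k[((I * I') * (J * J'))%type]} :=
  lext (fun p => basis ((p.1.1, p.2.1), (p.1.2, p.2.2))).

(* m_{13,2,4} : (b (x) a) (x) (b' (x) a') |-> b b' (x) (a (x) a') *)
Definition m1324 {I J : choiceType} (mu : {malg k[(J * J)%type]} -> {malg k[J]}) :
    {malg k[((J * I) * (J * I))%type]} -> {malg k[(J * (I * I))%type]} :=
  fun t => tmap mu id (tmid t).

End FreeSpaces.

Section Bialgebras.
Variable k : fieldType.

Record bialgebra_data (I : choiceType) := BialgebraData {
  bmul : {linear {malg k[(I * I)%type]} -> {malg k[I]}};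
  bone : {malg k[I]};
  bcomul : {linear {malg k[I]} -> {malg k[(I * I)%type]}};
  bcounit : {linear {malg k[I]} -> k^o}
}.

Record is_bialgebra (I : choiceType) (B : bialgebra_data I) : Prop :=
    IsBialgebra {
  bialg_mulA : forall x y z,
    bmul B (tens x (bmul B (tens y z))) = bmul B (tens (bmul B (tens x y)) z);
  bialg_mul1 : forall x, bmul B (tens (bone B) x) = x;
  bialg_mulr1 : forall x, bmul B (tens x (bone B)) = x;
  bialg_comulA : forall x,
    tassoc (tmap (bcomul B) id (bcomul B x)) = tmap id (bcomul B) (bcomul B x);
  bialg_counitl : forall x, tforml (bcounit B) (bcomul B x) = x;
  bialg_counitr : forall x, tformr (bcounit B) (bcomul B x) = x;
  bialg_comulM : forall x y,
    bcomul B (bmul B (tens x y)) =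
    tmap (bmul B) (bmul B) (tmid (tens (bcomul B x) (bcomul B y)));
  bialg_comul1 : bcomul B (bone B) = tens (bone B) (bone B);
  bialg_counitM : forall x y,
    bcounit B (bmul B (tens x y)) = (bcounit B x : k) * (bcounit B y : k);
  bialg_counit1 : bcounit B (bone B) = 1 :> k
}.

Record is_comodule_bialgebra (I J : choiceType)
    (A : bialgebra_data I) (B : bialgebra_data J)
    (delta : {linear {malg k[I]} -> {malg k[(J * I)%type]}}) : Prop :=
    IsComoduleBialgebra {
  cmb_bialgebraA : is_bialgebra A;
  cmb_bialgebraB : is_bialgebra B;
  cmb_coact : forall x,
    tassoc (tmap (bcomul B) id (delta x)) = tmap id delta (delta x);
  cmb_coact_counit : forall x, tforml (bcounit B) (delta x) = x;
  cmb_counit : forall x,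
    tformr (bcounit A) (delta x) = (bcounit A x : k) *: bone B;
  cmb_comul : forall x,
    tmap id (bcomul A) (delta x) =
    m1324 (bmul B) (tmap delta delta (bcomul A x));
  cmb_one : delta (bone A) = tens (bone B) (bone A);
  cmb_mul : forall t : {malg k[(I * I)%type]},
    delta (bmul A t) = tmap id (bmul A) (m1324 (bmul B) (tmap delta delta t))
}.

Definition is_double_bialgebra (I : choiceType)
    (mu : {linear {malg k[(I * I)%type]} -> {malg k[I]}}) (one : {malg k[I]})
    (Delta : {linear {malg k[I]} -> {malg k[(I * I)%type]}})
    (epsDelta : {linear {malg k[I]} -> k^o})
    (delta : {linear {malg k[I]} -> {malg k[(I * I)%type]}})
    (epsdelta : {linear {malg k[I]} -> k^o}) : Prop :=
  [/\ is_bialgebra (BialgebraData mu one Delta epsDelta),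
      is_bialgebra (BialgebraData mu one delta epsdelta) &
      is_comodule_bialgebra (BialgebraData mu one Delta epsDelta)
        (BialgebraData mu one delta epsdelta) delta].

End Bialgebras.

Record hypergraph := Hypergraph {
  edge : finType;
  vertex : finType;
  inc : edge -> {set vertex}
}.
Arguments inc {h} e.

Definition hiso (G1 G2 : hypergraph) : Prop :=
  exists (f : edge G1 -> edge G2) (g : vertex G1 -> vertex G2),
    [/\ bijective f, bijective g & forall e, inc (f e) = g @: inc e].

Lemma hiso_refl G : hiso G G.
Proof.
exists id, id; split; [by exists id | by exists id |].
by move=> e; rewrite imset_id.
Qed.

Lemma hiso_sym G1 G2 : hiso G1 G2 -> hiso G2 G1.
Proof.
case=> f [g [[f' fK f'K] [g' gK g'K] fg]]; exists f', g'; split.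
- by exists f.
- by exists g.
by move=> e; rewrite -{2}[e]f'K fg -imset_comp (eq_imset _ gK) imset_id.
Qed.

Lemma hiso_trans G1 G2 G3 : hiso G1 G2 -> hiso G2 G3 -> hiso G1 G3.
Proof.
case=> f [g [bf bg fg]] [f' [g' [bf' bg' fg']]].
exists (f' \o f), (g' \o g); split; [exact: bij_comp | exact: bij_comp |].
by move=> e /=; rewrite fg' fg imset_comp.
Qed.

Definition hisob (G1 G2 : hypergraph) : bool :=
  [&& #|edge G1| == #|edge G2|, #|vertex G1| == #|vertex G2| &
   [exists f : {ffun edge G1 -> edge G2},
      exists g : {ffun vertex G1 -> vertex G2},
        [&& injectiveb f, injectiveb g &
            [forall e, inc (f e) == g @: inc e]]]].

Lemma hisoP G1 G2 : reflect (hiso G1 G2) (hisob G1 G2).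
Proof.
apply: (iffP and3P) => [[/eqP ce /eqP cv /existsP[f /existsP[g]]]|].
  case/and3P=> /injectiveP fi /injectiveP gi /forallP fg.
  exists f, g; split; last by move=> e; apply/eqP.
    by apply: inj_card_bij fi _; rewrite ce.
  by apply: inj_card_bij gi _; rewrite cv.
case=> f [g [bf bg fg]]; split.
- by rewrite (bij_eq_card bf).
- by rewrite (bij_eq_card bg).
apply/existsP; exists (finfun f); apply/existsP; exists (finfun g).
apply/and3P; split.
- by apply/injectiveP => x y; rewrite !ffunE => /(bij_inj bf).
- by apply/injectiveP => x y; rewrite !ffunE => /(bij_inj bg).
apply/forallP => e; rewrite ffunE fg; apply/eqP/eq_imset => v.
by rewrite ffunE.
Qed.

(* Finite hypergraphs do not form a choiceType, so the quotient is taken on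
   hypergraphs carried by ordinals; [cls] sends any finite hypergraph to its
   class, and [clsP] says that classes are classes up to isomorphism. *)

Definition hcode := {n : nat & {m : nat & {ffun 'I_n -> {set 'I_m}}}}.

Definition hdecode (c : hcode) : hypergraph := Hypergraph (tagged (tagged c)).

Definition hencode (G : hypergraph) : hcode :=
  existT _ #|edge G| (existT _ #|vertex G|
    [ffun i => [set enum_rank v | v in inc (enum_val i)]]).

Lemma hencodeK G : hiso G (hdecode (hencode G)).
Proof.
exists enum_rank, enum_rank; split; [exact: enum_rank_bij.. |].
by move=> e /=; rewrite ffunE enum_rankK.
Qed.

Definition hcode_iso : rel hcode := fun c d => hisob (hdecode c) (hdecode d).

Lemma hcode_iso_refl : reflexive hcode_iso.
Proof. by move=> c; apply/hisoP/hiso_refl. Qed.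

Lemma hcode_iso_sym : symmetric hcode_iso.
Proof. by move=> c d; apply/hisoP/hisoP; apply: hiso_sym. Qed.

Lemma hcode_iso_trans : transitive hcode_iso.
Proof. by move=> d c e /hisoP cd /hisoP de; apply/hisoP/(hiso_trans cd). Qed.

Definition hcode_equiv :=
  EquivRel hcode_iso hcode_iso_refl hcode_iso_sym hcode_iso_trans.

Definition hclass : Type := {eq_quot hcode_equiv}.

HB.instance Definition _ := Choice.on hclass.
HB.instance Definition _ := EqQuotient.on hclass.

HB.lock Definition cls (G : hypergraph) : hclass := \pi_hclass (hencode G).
Canonical cls_unlockable := Unlockable cls.unlock.

HB.lock Definition rep (c : hclass) : hypergraph := hdecode (repr c).
Canonical rep_unlockable := Unlockable rep.unlock.

Lemma clsP G1 G2 : reflect (hiso G1 G2) (cls G1 == cls G2).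
Proof.
rewrite cls.unlock (@pi_eq_quot _ hcode_equiv hclass).
apply: (iffP (hisoP _ _)) => h.
  apply: hiso_trans (hencodeK _) _; apply: hiso_trans h _.
  exact/hiso_sym/hencodeK.
apply: hiso_trans (hiso_sym (hencodeK _)) _.
exact: hiso_trans h (hencodeK _).
Qed.

Lemma repK : cancel rep cls.
Proof.
move=> c; rewrite -[RHS]reprK; apply/eqP.
rewrite cls.unlock rep.unlock (@pi_eq_quot _ hcode_equiv hclass).
exact/hisoP/hiso_sym/hencodeK.
Qed.

Lemma rep_cls G : hiso (rep (cls G)) G.
Proof. by apply/clsP; rewrite repK. Qed.

Definition hempty : hypergraph :=
  @Hypergraph void void (fun _ => set0).

Definition hunion (G1 G2 : hypergraph) : hypergraph :=
  @Hypergraph (edge G1 + edge G2)%type (vertex G1 + vertex G2)%type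
    (fun e => match e with
              | inl e1 => [set inl v | v in inc e1]
              | inr e2 => [set inr v | v in inc e2]
              end).

Section Operations.
Variable G : hypergraph.
Implicit Types (F : {set edge G}) (U : {set vertex G}).

(* V^* *)
Definition vstar : {set vertex G} := [set v | [exists e, v \in inc e]].

Definition covered : bool := vstar == setT.

(* V_{|F} *)
Definition vonly F : {set vertex G} :=
  [set v | [forall e, (v \in inc e) ==> (e \in F)]].

(* (F, V_{|F}) *)
Definition hrestr F : hypergraph :=
  @Hypergraph {e : edge G | e \in F} {v : vertex G | v \in vonly F}
    (fun e => [set v | val v \in inc (val e)]).

(* (E, U) *)
Definition htrace U : hypergraph :=
  @Hypergraph (edge G) {v : vertex G | v \in U}
    (fun e => [set v | val v \in inc e]).

Definition hshare U : rel (edge G) :=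
  fun e e' => [exists v in U, (v \in inc e) && (v \in inc e')].

(* E/U; hshare is symmetric, so its reflexive transitive closure [connect] is
   the equivalence relation it generates *)
Definition edge_classes U : {set {set edge G}} :=
  equivalence_partition (connect (hshare U)) setT.

(* (E/U, U^c) *)
Definition hquot U : hypergraph :=
  @Hypergraph {C : {set edge G} | C \in edge_classes U}
    {v : vertex G | v \in ~: U}
    (fun C => [set v | [exists e in val C, val v \in inc e]]).

End Operations.

Lemma coveredP G : reflect (forall v : vertex G, exists e, v \in inc e) (covered G).
Proof.
apply: (iffP eqP) => [h v|h].
  by have := in_setT v; rewrite -h inE => /existsP.
by apply/setP => v; rewrite !inE; apply/existsP.
Qed.

Lemma covered_hiso G1 G2 : hiso G1 G2 -> covered G1 -> covered G2.
Proof.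
case=> f [g [_ [g' _ g'K] fg]] /coveredP c1; apply/coveredP => v.
have [e ve] := c1 (g' v); exists (f e).
by rewrite fg -[v]g'K imset_f.
Qed.

Lemma covered_hempty : covered hempty.
Proof. by apply/coveredP => -[]. Qed.

Lemma covered_hunion G1 G2 :
  covered G1 -> covered G2 -> covered (hunion G1 G2).
Proof.
move=> /coveredP c1 /coveredP c2; apply/coveredP => -[v|v].
  by have [e ve] := c1 v; exists (inl e); apply: imset_f.
by have [e ve] := c2 v; exists (inr e); apply: imset_f.
Qed.

Lemma covered_hrestr G (F : {set edge G}) : covered G -> covered (hrestr F).
Proof.
move=> /coveredP c; apply/coveredP => v; have [e ve] := c (val v).
have := valP v; rewrite /= inE => /forallP/(_ e)/implyP/(_ ve) eF.
by exists (exist _ e eF); rewrite inE.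
Qed.

Lemma covered_htrace G (U : {set vertex G}) :
  U \subset vstar G -> covered (htrace U).
Proof.
move=> /subsetP sU; apply/coveredP => v.
have := sU _ (valP v); rewrite inE => /existsP[e ve].
by exists e; rewrite inE.
Qed.

Lemma covered_hquot G (U : {set vertex G}) : covered G -> covered (hquot U).
Proof.
move=> /coveredP c; apply/coveredP => v; have [e ve] := c (val v).
have eC : [set e' in setT | connect (hshare U) e e'] \in edge_classes U.
  exact: imset_f.
exists (exist (fun C => C \in edge_classes U) _ eC).
rewrite inE; apply/existsP; exists e.
by rewrite !inE connect0.
Qed.

(* The basis of H^d: the classes of hypergraphs without isolated vertices. *)
Definition dclass : Type := {c : hclass | covered (rep c)}.

HB.instance Definition _ := Choice.on dclass.
HB.instance Definition _ := SubType.on dclass.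

Lemma covered_cls G : covered G -> covered (rep (cls G)).
Proof. exact/covered_hiso/hiso_sym/rep_cls. Qed.

Definition dcls G (cG : covered G) : dclass := exist _ (cls G) (covered_cls cG).

Definition drep (c : dclass) : hypergraph := rep (val c).

Lemma covered_drep c : covered (drep c).
Proof. by case: c. Qed.

Section HypergraphBialgebra.
Variable k : fieldType.

(* The operations below are defined on the representative [rep c] of a class;
   they do not depend on this choice. *)
Definition H_mul : {linear {malg k[(hclass * hclass)%type]} -> {malg k[hclass]}} :=
  lext (fun p => basis (cls (hunion (rep p.1) (rep p.2)))).

Definition H_one : {malg k[hclass]} := basis (cls hempty).

(* Delta^d *)
Definition H_Delta : {linear {malg k[hclass]} -> {malg k[(hclass * hclass)%type]}} :=
  lext (fun c => \sum_(F : {set edge (rep c)})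
                   basis (cls (hrestr F), cls (hrestr (~: F)))).

Definition H_epsDelta : {linear {malg k[hclass]} -> k^o} :=
  lext (fun c => (#|edge (rep c)| == 0%N)%:R).

(* delta^d : H -> H^d (x) H *)
Definition H_delta : {linear {malg k[hclass]} -> {malg k[(dclass * hclass)%type]}} :=
  lext (fun c => \sum_(U : {U : {set vertex (rep c)} | U \subset vstar (rep c)})
                   basis (dcls (covered_htrace (valP U)), cls (hquot (val U)))).

Definition Hd_mul : {linear {malg k[(dclass * dclass)%type]} -> {malg k[dclass]}} :=
  lext (fun p => basis (dcls (covered_hunion (covered_drep p.1) (covered_drep p.2)))).

Definition Hd_one : {malg k[dclass]} := basis (dcls covered_hempty).

Definition Hd_Delta : {linear {malg k[dclass]} -> {malg k[(dclass * dclass)%type]}} :=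
  lext (fun c => \sum_(F : {set edge (drep c)})
                   basis (dcls (covered_hrestr F (covered_drep c)),
                       dcls (covered_hrestr (~: F) (covered_drep c)))).

Definition Hd_epsDelta : {linear {malg k[dclass]} -> k^o} :=
  lext (fun c => (#|edge (drep c)| == 0%N)%:R).

Definition Hd_delta : {linear {malg k[dclass]} -> {malg k[(dclass * dclass)%type]}} :=
  lext (fun c => \sum_(U : {U : {set vertex (drep c)} | U \subset vstar (drep c)})
                   basis (dcls (covered_htrace (valP U)),
                       dcls (covered_hquot (val U) (covered_drep c)))).

Definition Hd_epsdelta : {linear {malg k[dclass]} -> k^o} :=
  lext (fun c => (#|vertex (drep c)| == 0%N)%:R).

(* (H, mu, Delta^d) *)
Definition H_bialgebra : bialgebra_data k hclass :=
  BialgebraData H_mul H_one H_Delta H_epsDelta.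

(* (H^d, mu, delta^d) *)
Definition Hd_bialgebra : bialgebra_data k dclass :=
  BialgebraData Hd_mul Hd_one Hd_delta Hd_epsdelta.

(* The inclusion of H^d in H; by the lemmas below, the product, the unit,
   Delta^d and its counit, and delta^d on H^d are the restrictions of those
   of H. *)
Definition Hd_incl : {linear {malg k[dclass]} -> {malg k[hclass]}} :=
  lext (fun c : dclass => basis (val c)).

Lemma Hd_incl_inj : injective Hd_incl.
Proof.
pose r : {linear {malg k[hclass]} -> {malg k[dclass]}} :=
  lext (fun c => if insub c is Some d then basis d else 0).
apply: (can_inj (g := r)); apply: (@lin_ext _ _ _ (r \o Hd_incl) idfun) => c /=.
by rewrite !lextU valK.
Qed.

Lemma Hd_mulE t : Hd_incl (Hd_mul t) = H_mul (tmap Hd_incl Hd_incl t).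
Proof.
apply: (@lin_ext _ _ _ (Hd_incl \o Hd_mul) (H_mul \o tmap Hd_incl Hd_incl)).
by move=> [c d]; rewrite /= tmapU !lextU tensUU lextU.
Qed.

Lemma Hd_oneE : Hd_incl Hd_one = H_one.
Proof. by rewrite /= lextU. Qed.

Lemma Hd_DeltaE x : tmap Hd_incl Hd_incl (Hd_Delta x) = H_Delta (Hd_incl x).
Proof.
apply: (@lin_ext _ _ _ (tmap Hd_incl Hd_incl \o Hd_Delta) (H_Delta \o Hd_incl)).
move=> c; rewrite /= !lextU linear_sum /=; apply: eq_bigr => F _.
by rewrite tmapU !lextU tensUU.
Qed.

Lemma Hd_epsDeltaE x : Hd_epsDelta x = H_epsDelta (Hd_incl x).
Proof.
apply: (@lin_ext _ _ _ Hd_epsDelta (H_epsDelta \o Hd_incl)) => c.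
by rewrite /= !lextU.
Qed.

Lemma Hd_deltaE x : tmap id Hd_incl (Hd_delta x) = H_delta (Hd_incl x).
Proof.
apply: (@lin_ext _ _ _ (tmap id Hd_incl \o Hd_delta) (H_delta \o Hd_incl)).
move=> c; rewrite /= !lextU linear_sum /=; apply: eq_bigr => U _.
by rewrite tmapU lextU tensUU.
Qed.

End HypergraphBialgebra.

(* Main.v *)
Require Import Defs.
From HB Require Import structures.
From mathcomp Require Import all_boot all_algebra.

(* Every hypergraph obtained from G by iterating Delta^d and delta^d is a
   subquotient (P/U, Q): a set P of edges of G, glued along a set U of vertices,
   with a set Q of remaining vertices. On these,
     Delta^d (P/U, Q) = sum over the U-saturated A in P of
                        (A/U, Q_{|A}) (x) ((P - A)/U, Q_{|P - A}),
     delta^d (P/U, Q) = sum over W in Q^* of (P/U, W) (x) (P/(U + W), Q - W),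
   and the disjoint union of two subquotients without incidence between them is
   the union of their data. Each axiom on H then becomes a reindexing of sums over
   subsets of one fixed hypergraph; compatibility of Delta^d and delta^d says that
   A is saturated for U in V^* iff U is the union of U1 in (V_{|A})^* and
   U2 in (V_{|A^c})^*. The axioms on H^d follow by restriction, except those
   involving the right counit of delta^d and its multiplicativity. *)

Set Implicit Arguments.
Unset Strict Implicit.
Unset Printing Implicit Defensive.
Import GRing.Theory.
Local Open Scope ring_scope.

(** * Subquotients of a hypergraph *)

(** The operations act on [rep c], a representative picked by choice, so an iterated coproduct lives
    on representatives of pieces of representatives, which carry no given map to the original
    hypergraph. [presents] records what survives any isomorphism: an injection of the edges into
    sets of edges of G and an injection of the vertices into those of G. Every such representative
    can then be read inside G, and two of them are identified as soon as their data (P, U, Q) agree.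
    The gluing is remembered as a set U of vertices rather than as a partition of P. Successive
    quotients then compose by taking unions of vertex sets, and iterated quotient types never have
    to be compared. *)

Lemma hshareC G (U : {set vertex G}) : symmetric (hshare U).
Proof. by move=> e e'; apply: eq_existsb => v; rewrite [X in _ && X]andbC. Qed.

Lemma hshareP G (U : {set vertex G}) (e e' : edge G) :
  reflect (exists v, [/\ v \in U, v \in inc e & v \in inc e']) (hshare U e e').
Proof.
apply: (iffP existsP) => -[v].
  by case/and3P=> ? ? ?; exists v.
by case=> ? ? ?; exists v; apply/and3P.
Qed.

Section SubQuotients.
Variable G : hypergraph.
Implicit Types (P A : {set edge G}) (U Q W : {set vertex G}) (e : edge G).

(** Both ends are required to lie in P: edges outside P must not serve as intermediate links, and P
    becomes closed under the relation, so that the class of an edge of P stays in P. *)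
Definition adj P U : rel (edge G) :=
  fun e e' => [&& e \in P, e' \in P & hshare U e e'].

Definition ecl P U e : {set edge G} := [set e' | connect (adj P U) e e'].

(* The subquotient (P/U, Q) of G: the edges of P are glued along the vertices
   of U, and only the vertices of Q are kept. *)
Definition hsubq P U Q : hypergraph :=
  @Hypergraph {C : {set edge G} | C \in ecl P U @: P} {v : vertex G | v \in Q}
    (fun C => [set v | [exists e in val C, val v \in inc e]]).

(* X is a copy of (P/U, Q), with t sending an edge of X to the class it
   represents. *)
Record presents P U Q X (t : edge X -> {set edge G})
    (q : vertex X -> vertex G) : Prop := Presents {
  pres_tI : injective t;
  pres_qI : injective q;
  pres_tcl : forall x, exists2 e, e \in P & t x = ecl P U e;
  pres_ton : forall e, e \in P -> exists x, t x = ecl P U e;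
  pres_qin : forall v, q v \in Q;
  pres_qon : forall v, v \in Q -> exists w, q w = v;
  pres_inc : forall x v, (v \in inc x) = [exists e in t x, q v \in inc e]
}.

Lemma adjC P U : symmetric (adj P U).
Proof. by move=> e e'; rewrite /adj hshareC andbCA. Qed.

Lemma adj_csym P U : connect_sym (adj P U).
Proof. exact/sym_connect_sym/adjC. Qed.

Lemma ecl_id P U e : e \in ecl P U e.
Proof. by rewrite inE connect0. Qed.

Lemma eclE P U e e' : e' \in ecl P U e -> ecl P U e' = ecl P U e.
Proof.
rewrite inE => h; apply/setP => f; rewrite !inE.
by rewrite (same_connect (@adj_csym P U) h).
Qed.

Lemma adj_closed P U : closed (adj P U) (mem P).
Proof. by move=> e e' /and3P[/= -> ->]. Qed.

Lemma ecl_sub P U e : e \in P -> ecl P U e \subset P.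
Proof.
move=> eP; apply/subsetP => e'; rewrite inE => h.
by have := closed_connect (@adj_closed P U) h; rewrite /= eP.
Qed.

Lemma eq_ecl P U A W : adj P U =2 adj A W -> ecl P U =1 ecl A W.
Proof. by move=> h e; apply/setP => e'; rewrite !inE (eq_connect h). Qed.

Lemma hsubq_presents P U Q :
  @presents P U Q (hsubq P U Q) (fun C => val C) (fun v => val v).
Proof.
split; try exact: val_inj.
- by move=> C; have /imsetP[e eP ->] := valP C; exists e.
- by move=> e eP; exists (exist (fun C => C \in _) _ (imset_f (ecl P U) eP)).
- by move=> v; apply: valP.
- by move=> v vQ; exists (exist (fun v => v \in Q) _ vQ).
by move=> x v; rewrite inE.
Qed.

(** The data (P, U, Q) determine the images of t and q. Matching edges and vertices with equal
    images gives maps both ways, and injectivity of t and q makes them mutually inverse. *)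
Lemma presents_hiso P U Q X Y t q t' q' :
  @presents P U Q X t q -> @presents P U Q Y t' q' -> hiso X Y.
Proof.
move=> hX hY.
have eqf (Z1 Z2 : hypergraph) t1 t2 q1 q2 (h1 : @presents P U Q Z1 t1 q1)
    (h2 : @presents P U Q Z2 t2 q2) :
  (exists f, forall x, t2 (f x) = t1 x) /\ (exists g, forall v, q2 (g v) = q1 v).
  split.
    apply: (@fin_all_exists _ (fun=> edge Z2) (fun x y => t2 y = t1 x)) => x.
    by have [e eP ->] := pres_tcl h1 x; apply: pres_ton h2 _ eP.
  apply: (@fin_all_exists _ (fun=> vertex Z2) (fun v w => q2 w = q1 v)) => v.
  exact: pres_qon h2 _ (pres_qin h1 v).
have [[f fE] [g gE]] := eqf _ _ _ _ _ _ hX hY.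
have [[f' fE'] [g' gE']] := eqf _ _ _ _ _ _ hY hX.
exists f, g; split.
- exists f' => x; first by apply: (pres_tI hX); rewrite fE' fE.
  by apply: (pres_tI hY); rewrite fE fE'.
- exists g' => x; first by apply: (pres_qI hX); rewrite gE' gE.
  by apply: (pres_qI hY); rewrite gE gE'.
have gK : cancel g' g by move=> x; apply: (pres_qI hY); rewrite gE gE'.
have g'K : cancel g g' by move=> x; apply: (pres_qI hX); rewrite gE' gE.
move=> x; apply/setP => v; rewrite -[v]gK mem_imset; last exact: can_inj g'K.
by rewrite (pres_inc hY) (pres_inc hX) fE gE.
Qed.

Lemma presents_cls P U Q X t q :
  @presents P U Q X t q -> cls X = cls (hsubq P U Q).
Proof.
by move=> h; apply/eqP/clsP; apply: presents_hiso h (hsubq_presents _ _ _).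
Qed.

Lemma hiso_presents P U Q X Y t q :
  @presents P U Q X t q -> hiso Y X ->
  exists t' q', @presents P U Q Y t' q'.
Proof.
move=> h [f [g [[f' fK f'K] [g' gK g'K] fg]]].
exists (t \o f), (q \o g); split => [||x|e eP|v|v vQ|x v] /=.
- exact: inj_comp (pres_tI h) (can_inj fK).
- exact: inj_comp (pres_qI h) (can_inj gK).
- exact: pres_tcl h _.
- by have [x <-] := pres_ton h eP; exists (f' x); rewrite f'K.
- exact: pres_qin h _.
- by have [x <-] := pres_qon h vQ; exists (g' x); rewrite /= g'K.
by rewrite -(pres_inc h) fg mem_imset //; apply: can_inj gK.
Qed.

(** The entry point for every computation: the representative on which an operation is evaluated is
    again a copy of (P/U, Q). *)
Lemma rep_presents P U Q :
  exists t q, @presents P U Q (rep (cls (hsubq P U Q))) t q.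
Proof. exact: hiso_presents (hsubq_presents _ _ _) (rep_cls _). Qed.

Lemma ecl0 P e : ecl P set0 e = [set e].
Proof.
apply/setP => e'; rewrite !inE; apply/idP/eqP => [|-> //].
have cl : closed (adj P set0) (pred1 e).
  by move=> x y /and3P[_ _ /hshareP[v []]]; rewrite inE.
move=> h; apply/eqP; have := closed_connect cl h.
by rewrite !inE eqxx => <-.
Qed.

Lemma embed_presents X (f : edge X -> edge G) (g : vertex X -> vertex G) :
  injective f -> injective g ->
  (forall x v, (g v \in inc (f x)) = (v \in inc x)) ->
  @presents (f @: setT) set0 (g @: setT) X (fun x => [set f x]) g.
Proof.
move=> fI gI fg; split => //.
- by move=> x y /set1_inj/fI.
- by move=> x; exists (f x); rewrite ?ecl0 ?imset_f.
- by move=> _ /imsetP[x _ ->]; exists x; rewrite ecl0.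
- by move=> v; apply: imset_f.
- by move=> _ /imsetP[v _ ->]; exists v.
move=> x v; rewrite -fg; apply/idP/existsP => [h|[e]].
  by exists (f x); rewrite set11.
by rewrite inE => /andP[/eqP ->].
Qed.

Lemma presents_self : @presents setT set0 setT G (fun e => [set e]) id.
Proof.
have := @embed_presents G id id (@inj_id _) (@inj_id _) (fun _ _ => erefl _).
by rewrite !imset_id.
Qed.

Lemma cls_self : cls G = cls (hsubq setT set0 setT).
Proof. exact: presents_cls presents_self. Qed.

(** The gluing set enters only through the adjacencies it creates between edges of P, so different
    sets U and W may give the same subquotient. *)
Lemma eq_cls_hsubq P U A W Q : P = A -> {in P &, hshare U =2 hshare W} ->
  cls (hsubq P U Q) = cls (hsubq A W Q).
Proof.
move=> <- h.
have eUW : adj P U =2 adj P W.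
  move=> e e'; rewrite /adj; case eP: (e \in P) => //=.
  by case e'P: (e' \in P) => //=; apply: h.
apply/esym; apply: (@presents_cls P U Q (hsubq P W Q) (fun C => val C) (fun v => val v)).
have [tI qI tc to qi qo hi] := hsubq_presents P W Q.
split=> // [x|e eP].
  by have [e eP tx] := tc x; exists e => //; rewrite (eq_ecl eUW).
by have [x tx] := to e eP; exists x; rewrite (eq_ecl eUW).
Qed.

Section Presented.
Variables (P : {set edge G}) (U Q : {set vertex G}) (X : hypergraph).
Variables (t : edge X -> {set edge G}) (q : vertex X -> vertex G).
Hypothesis hX : @presents P U Q X t q.

Lemma pres_mem x e : e \in t x -> e \in P /\ t x = ecl P U e.
Proof.
have [f fP ->] := pres_tcl hX x => ef; split; last by rewrite (eclE ef).
by apply: subsetP ef; apply: ecl_sub.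
Qed.

Lemma pres_inj x y e : e \in t x -> e \in t y -> x = y.
Proof.
move=> ex ey; apply: (pres_tI hX).
by rewrite (pres_mem ex).2 (pres_mem ey).2.
Qed.

Lemma pres_ex x : exists e, e \in t x.
Proof. by have [e _ ->] := pres_tcl hX x; exists e; apply: ecl_id. Qed.

Lemma pres_cov e : e \in P -> exists x, e \in t x.
Proof. by move=> /(pres_ton hX)[x tx]; exists x; rewrite tx ecl_id. Qed.

End Presented.

Definition saturated P U A :=
  (A \subset P) && [forall e in A, forall e', adj P U e e' ==> (e' \in A)].

Lemma saturatedP P U A :
  reflect (A \subset P /\ closed (adj P U) (mem A)) (saturated P U A).
Proof.
apply: (iffP andP) => -[sA hA]; split => //.
  have h e e' : adj P U e e' -> e \in A -> e' \in A.
    move=> ee' eA; have /implyP/(_ eA) := forallP hA e.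
    by move=> /forallP/(_ e')/implyP/(_ ee').
  move=> e e' ee'; apply/idP/idP; apply: h => //.
  by rewrite adjC.
apply/forallP => e; apply/implyP => eA; apply/forallP => e'; apply/implyP => h.
by rewrite -(hA _ _ h).
Qed.

Lemma saturatedC P U A : saturated P U A -> saturated P U (P :\: A).
Proof.
case/saturatedP=> sA hA; apply/saturatedP; split; first exact: subsetDl.
move=> e e' h; rewrite /= !inE; have /= -> := hA _ _ h.
by case/and3P: h => -> ->.
Qed.

(** A path that starts in a saturated set never leaves it. *)
Lemma saturated_ecl P U A e : saturated P U A -> e \in A -> ecl A U e = ecl P U e.
Proof.
case/saturatedP=> sA hA eA; apply/setP => e'; rewrite !inE; apply/idP/idP.
  apply: connect_sub => x y /and3P[xA yA xy]; apply: connect1.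
  by rewrite /adj (subsetP sA _ xA) (subsetP sA _ yA).
case/connectP=> p; elim: p e eA => [|y p IH] e eA /=.
  by move=> _ ->; rewrite connect0.
case/andP=> ey yp e'l; have yA : y \in A by have := hA _ _ ey; rewrite /= eA.
apply: connect_trans (IH y yA yp e'l); apply: connect1.
by rewrite /adj eA yA; case/and3P: ey.
Qed.

Lemma saturated0 P A : saturated P set0 A = (A \subset P).
Proof.
apply/saturatedP/idP => [[] //|sA]; split=> // x y.
by case/and3P=> _ _ /hshareP[v []]; rewrite inE.
Qed.

(* V_{|A}, relatively to (P, Q) *)
Definition ronly P Q A :=
  [set v in Q | [forall e in P, (v \in inc e) ==> (e \in A)]].

Lemma ronlyP P Q A v :
  reflect (v \in Q /\ forall e, e \in P -> v \in inc e -> e \in A)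
    (v \in ronly P Q A).
Proof.
rewrite inE; apply: (iffP andP) => -[vQ h]; split => //.
  by move=> e eP ve; move/forallP/(_ e): h; rewrite eP ve.
by apply/forallP => e; apply/implyP => eP; apply/implyP; apply: h.
Qed.

(* V^* for (P, Q) *)
Definition rstar P Q := [set v in Q | [exists e in P, v \in inc e]].

Lemma rstarP P Q v :
  reflect (v \in Q /\ exists2 e, e \in P & v \in inc e) (v \in rstar P Q).
Proof.
by rewrite inE; apply: (iffP andP) => -[vQ]; [move/exists_inP|move=> h];
  split=> //; apply/exists_inP.
Qed.

Section Comultiplications.
Variables (P : {set edge G}) (U Q : {set vertex G}) (X : hypergraph).
Variables (t : edge X -> {set edge G}) (q : vertex X -> vertex G).
Hypothesis hX : @presents P U Q X t q.

Definition usum (F : {set edge X}) : {set edge G} := \bigcup_(x in F) t x.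

Lemma usumP (F : {set edge X}) e :
  reflect (exists2 x, x \in F & e \in t x) (e \in usum F).
Proof. exact: bigcupP. Qed.

Lemma mem_usum (F : {set edge X}) x e : e \in t x -> (e \in usum F) = (x \in F).
Proof.
move=> ex; apply/usumP/idP => [[y yF ey]|xF]; last by exists x.
by rewrite (pres_inj hX ex ey).
Qed.

Lemma usum_inj : injective usum.
Proof.
move=> F F' eF; apply/setP => x; have [e ex] := pres_ex hX x.
by rewrite -(mem_usum F ex) eF (mem_usum _ ex).
Qed.

Lemma usum_compl F : usum (~: F) = P :\: usum F.
Proof.
apply/setP => e; rewrite inE; case eP: (e \in P); last first.
  rewrite andbF; apply/usumP => -[x _ /(pres_mem hX)[]].
  by rewrite eP.
have [x ex] := pres_cov hX eP.
by rewrite !(mem_usum _ ex) inE andbT.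
Qed.

Lemma usum_saturated F : saturated P U (usum F).
Proof.
apply/saturatedP; split.
  by apply/subsetP => e /usumP[x _ /(pres_mem hX)[]].
move=> e e' ee'; have [eP e'P _] := and3P ee'; have [x ex] := pres_cov hX eP.
have e'x : e' \in t x by rewrite (pres_mem hX ex).2 inE connect1.
by rewrite /= (mem_usum _ ex) (mem_usum _ e'x).
Qed.

(** Together with [usum_inj], this turns a sum over sets of edges of X into a sum over saturated
    subsets of P: saturated sets are exactly the unions of classes. *)
Lemma usum_imset : usum @: setT = [set A | saturated P U A].
Proof.
apply/setP => A; rewrite inE; apply/imsetP/idP => [[F _ ->]|sA].
  exact: usum_saturated.
exists [set x | t x \subset A]; first by rewrite inE.
have [sAP cA] := saturatedP _ _ _ sA.
apply/setP => e; apply/idP/usumP => [eA|[x]]; last first.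
  by rewrite inE => /subsetP; apply.
have eP := subsetP sAP _ eA; have [x ex] := pres_cov hX eP.
exists x => //; rewrite inE (pres_mem hX ex).2 -(saturated_ecl sA eA).
exact: ecl_sub.
Qed.

Lemma hrestr_presents F :
  @presents (usum F) U (ronly P Q (usum F)) (hrestr F)
    (fun x => t (val x)) (fun v => q (val v)).
Proof.
have vE v : (q v \in ronly P Q (usum F)) = (v \in vonly F).
  rewrite [in RHS]inE; apply/ronlyP/forallP => [[_ h] x|h].
    apply/implyP; rewrite (pres_inc hX) => /exists_inP[e ex ve].
    rewrite -(mem_usum _ ex); apply: h => //.
    by have [] := pres_mem hX ex.
  split; first exact: pres_qin hX _.
  move=> e eP ve; have [x ex] := pres_cov hX eP; rewrite (mem_usum _ ex).
  by apply: (implyP (h x)); rewrite (pres_inc hX); apply/exists_inP; exists e.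
split => [x y /(pres_tI hX)/val_inj //|x y /(pres_qI hX)/val_inj //|x|e eF|v|v|x v].
- have [e ex] := pres_ex hX (val x); have eF : e \in usum F.
    by rewrite (mem_usum _ ex) (valP x).
  by exists e => //; rewrite (saturated_ecl (usum_saturated F)) // (pres_mem hX ex).2.
- have /usumP[x xF ex] := eF; exists (exist (fun x => x \in F) x xF).
  by rewrite /= (saturated_ecl (usum_saturated F)) // (pres_mem hX ex).2.
- by rewrite vE (valP v).
- move=> vr; have [vQ _] := ronlyP _ _ _ _ vr; have [w wv] := pres_qon hX vQ.
  by move: vr; rewrite -wv vE => wF; exists (exist (fun w => w \in vonly F) w wF).
by rewrite inE (pres_inc hX).
Qed.

Lemma vstar_presents (W : {set vertex X}) :
  (W \subset vstar X) = (q @: W \subset rstar P Q).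
Proof.
have vE v : (q v \in rstar P Q) = (v \in vstar X).
  rewrite [in RHS]inE; apply/rstarP/existsP => [[_ [e eP ve]]|[x]].
    have [x ex] := pres_cov hX eP.
    by exists x; rewrite (pres_inc hX); apply/exists_inP; exists e.
  rewrite (pres_inc hX) => /exists_inP[e ex ve]; split.
    exact: pres_qin hX _.
  by exists e => //; have [] := pres_mem hX ex.
apply/subsetP/subsetP => h.
  by move=> _ /imsetP[v vW ->]; rewrite vE h.
by move=> v vW; rewrite -vE h ?imset_f.
Qed.

Lemma htrace_presents (W : {set vertex X}) :
  @presents P U (q @: W) (htrace W) t (fun v => q (val v)).
Proof.
split => [|x y /(pres_qI hX)/val_inj //|x|e eP|v|v|x v].
- exact: pres_tI hX.
- exact: pres_tcl hX x.
- exact: pres_ton hX e eP.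
- by rewrite imset_f ?(valP v).
- by case/imsetP=> w wW ->; exists (exist (fun w => w \in W) w wW).
by rewrite inE (pres_inc hX).
Qed.

(** Gluing along U and then along W amounts to gluing once along the union: a path of edges of G
    projects to a path of classes, and conversely each class is itself connected through U. *)
Lemma quot_connect (W : {set vertex X}) x y e e' : e \in t x -> e' \in t y ->
  connect (adj P (U :|: q @: W)) e e' = connect (hshare W) x y.
Proof.
move=> ex ey.
have sub f f' z : f \in t z -> f' \in t z ->
    connect (adj P (U :|: q @: W)) f f'.
  move=> fz f'z; move: f'z; rewrite (pres_mem hX fz).2 inE.
  apply: connect_sub => a b /and3P[aP bP /hshareP[v [vU va vb]]].
  apply/connect1/and3P; split => //; apply/hshareP; exists v.
  by rewrite inE vU.
apply/idP/idP.
  case/connectP=> p; elim: p e x ex => [|f p IH] e x ex /=.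
    by move=> _ eqe; rewrite -eqe in ex; rewrite (pres_inj hX ex ey) connect0.
  case/andP=> ef fp e'l; have [eP fP /hshareP[v [vUW ve vf]]] := and3P ef.
  have [z fz] := pres_cov hX fP; apply: connect_trans (IH f z fz fp e'l).
  (* A link through U stays inside the current class, while a link through [q @: W] is an adjacency
     between classes in X. *)
  case/setUP: vUW => [vU|/imsetP[w wW wv]].
    suff fx : f \in t x by rewrite (pres_inj hX fz fx) connect0.
    rewrite (pres_mem hX ex).2 inE; apply/connect1/and3P; split=> //.
    by apply/hshareP; exists v.
  apply/connect1/hshareP; exists w; split => //.
    by rewrite (pres_inc hX); apply/exists_inP; exists e; rewrite -?wv.
  by rewrite (pres_inc hX); apply/exists_inP; exists f; rewrite -?wv.
case/connectP=> p; elim: p e x ex => [|z p IH] e x ex /=.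
  by move=> _ eqx; rewrite -eqx in ex; apply: sub ex ey.
case/andP=> /hshareP[w [wW]]; rewrite !(pres_inc hX).
case/exists_inP=> a ax wa /exists_inP[b bz wb] zp yl.
apply: connect_trans (IH b z bz zp yl).
apply: connect_trans (sub _ _ _ ex ax) _; apply/connect1/and3P; split.
- by have [] := pres_mem hX ax.
- by have [] := pres_mem hX bz.
by apply/hshareP; exists (q w); rewrite inE imset_f ?orbT.
Qed.

Lemma hquot_presents (W : {set vertex X}) :
  @presents P (U :|: q @: W) (Q :\: q @: W) (hquot W)
    (fun C => usum (val C)) (fun v => q (val v)).
Proof.
have clE x e : e \in t x ->
  usum [set y in setT | connect (hshare W) x y] = ecl P (U :|: q @: W) e.
  move=> ex; apply/setP => f; rewrite [in RHS]inE.
  apply/usumP/idP => [[y]|h].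
    by rewrite !inE => xy fy; rewrite (quot_connect W ex fy).
  have fP : f \in P.
    have := closed_connect (@adj_closed P (U :|: q @: W)) h.
    by rewrite /= (pres_mem hX ex).1.
  have [y fy] := pres_cov hX fP; exists y => //.
  by rewrite !inE -(quot_connect W ex fy).
split => [x y /usum_inj/val_inj //|x y /(pres_qI hX)/val_inj //|C|e eP|v|v|C v].
- have /imsetP[x _ ->] := valP C; have [e ex] := pres_ex hX x.
  by exists e; [have [] := pres_mem hX ex | rewrite (clE x e)].
- have [x ex] := pres_cov hX eP.
  have hC : [set y in setT | connect (hshare W) x y] \in edge_classes W.
    exact: imset_f.
  by exists (exist (fun C => C \in edge_classes W) _ hC); rewrite /= (clE x e).
- rewrite inE (pres_qin hX) mem_imset ?andbT; last exact: pres_qI hX.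
  by have := valP v; rewrite /= inE.
- case/setDP=> vQ; have [w <-] := pres_qon hX vQ.
  rewrite mem_imset => [wW|]; last exact: pres_qI hX.
  have wC : w \in ~: W by rewrite inE.
  by exists (exist (fun w => w \in ~: W) w wC).
rewrite inE; apply/exists_inP/exists_inP => [[x xC]|[e /usumP[x xC ex] ve]].
  rewrite (pres_inc hX) => /exists_inP[e ex ve]; exists e => //.
  by apply/usumP; exists x.
by exists x => //; rewrite (pres_inc hX); apply/exists_inP; exists e.
Qed.

End Comultiplications.

(** The incidence hypotheses prevent a vertex of U1 or U2 from linking an edge of P1 to an edge of
    P2. Hence P1 and P2 are saturated in their union, and the classes of the union are those
    computed on each side. *)
Lemma hunion_presents (P1 P2 : {set edge G}) (U1 U2 Q1 Q2 : {set vertex G}) X Y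
    t1 q1 t2 q2 :
  @presents P1 U1 Q1 X t1 q1 -> @presents P2 U2 Q2 Y t2 q2 ->
  [disjoint P1 & P2] -> [disjoint Q1 & Q2] ->
  (forall e v, e \in P1 -> v \in inc e -> v \notin U2 :|: Q2) ->
  (forall e v, e \in P2 -> v \in inc e -> v \notin U1 :|: Q1) ->
  @presents (P1 :|: P2) (U1 :|: U2) (Q1 :|: Q2) (hunion X Y)
    (fun x => match x with inl x => t1 x | inr y => t2 y end)
    (fun x => match x with inl x => q1 x | inr y => q2 y end).
Proof.
move=> h1 h2 dP dQ hU2 hU1.
have sP1 : saturated (P1 :|: P2) (U1 :|: U2) P1.
  apply/saturatedP; split; first exact: subsetUl.
  move=> e e' /and3P[+ + /hshareP[v [vU ve ve']]].
  rewrite !inE => /orP[eP|eP] /orP[e'P|e'P]; rewrite /= ?eP ?e'P //.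
    have := hU2 _ _ eP ve; have := hU1 _ _ e'P ve'; rewrite !inE.
    by move: vU; rewrite inE => /orP[] ->.
    have := hU1 _ _ eP ve; have := hU2 _ _ e'P ve'; rewrite !inE.
    by move: vU; rewrite inE => /orP[] ->.
  by rewrite !(disjointFl dP).
have sP2 : saturated (P1 :|: P2) (U1 :|: U2) P2.
  have := saturatedC sP1; rewrite setDUl setDv set0U.
  by have /setDidPl -> : [disjoint P2 & P1] by rewrite disjoint_sym.
have e1 e : e \in P1 -> ecl (P1 :|: P2) (U1 :|: U2) e = ecl P1 U1 e.
  move=> eP; rewrite -(saturated_ecl sP1 eP); apply: eq_ecl => a b.
  rewrite /adj; case aP: (a \in P1) => //=; case bP: (b \in P1) => //=.
  apply/hshareP/hshareP => -[v [vU va vb]]; exists v; split => //.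
    have := hU2 _ _ aP va; rewrite inE negb_or => /andP[vU2 _].
    by move: vU; rewrite inE (negPf vU2) orbF.
  by rewrite inE vU.
have e2 e : e \in P2 -> ecl (P1 :|: P2) (U1 :|: U2) e = ecl P2 U2 e.
  move=> eP; rewrite -(saturated_ecl sP2 eP); apply: eq_ecl => a b.
  rewrite /adj; case aP: (a \in P2) => //=; case bP: (b \in P2) => //=.
  apply/hshareP/hshareP => -[v [vU va vb]]; exists v; split => //.
    have := hU1 _ _ aP va; rewrite inE negb_or => /andP[vU2 _].
    by move: vU; rewrite inE (negPf vU2).
  by rewrite inE vU orbT.
have tN x y : t1 x <> t2 y.
  move=> e12; have [e ex] := pres_ex h1 x; have := ex; rewrite e12 => ey.
  have [eP _] := pres_mem h1 ex; have [eP' _] := pres_mem h2 ey.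
  by have := disjointFr dP eP; rewrite eP'.
have qN x y : q1 x <> q2 y.
  move=> e12; have := disjointFr dQ (pres_qin h1 x).
  by rewrite e12 (pres_qin h2).
split.
- move=> [x|x] [y|y] => [/(pres_tI h1) -> //|/tN []|/esym/tN []|].
  by move/(pres_tI h2) ->.
- move=> [x|x] [y|y] => [/(pres_qI h1) -> //|/qN []|/esym/qN []|].
  by move/(pres_qI h2) ->.
- move=> [x|x]; first have [e eP ->] := pres_tcl h1 x.
    by exists e; rewrite ?e1 // inE eP.
  by have [e eP ->] := pres_tcl h2 x; exists e; rewrite ?e2 // inE eP orbT.
- move=> e /setUP[] eP.
    by have [x tx] := pres_ton h1 eP; exists (inl x); rewrite e1.
  by have [x tx] := pres_ton h2 eP; exists (inr x); rewrite e2.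
- by move=> [v|v]; rewrite inE ?(pres_qin h1) ?(pres_qin h2) ?orbT.
- move=> v /setUP[] vQ.
    by have [w wv] := pres_qon h1 vQ; exists (inl w).
  by have [w wv] := pres_qon h2 vQ; exists (inr w).
move=> [x|x] [v|v] /=.
- rewrite mem_imset; last exact: inl_inj.
  exact: pres_inc h1 x v.
- rewrite (_ : _ \in _ = false); last by apply/imsetP => -[].
  apply/esym/exists_inP => -[e ex ve]; have [eP _] := pres_mem h1 ex.
  by have := hU2 _ _ eP ve; rewrite inE (pres_qin h2) orbT.
- rewrite (_ : _ \in _ = false); last by apply/imsetP => -[].
  apply/esym/exists_inP => -[e ex ve]; have [eP _] := pres_mem h2 ex.
  by have := hU1 _ _ eP ve; rewrite inE (pres_qin h1) orbT.
rewrite mem_imset; last exact: inr_inj.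
exact: pres_inc h2 x v.
Qed.

End SubQuotients.

(** * Linear maps on tensor products *)

Section TensorCalculus.
Variable k : fieldType.

Definition tensl {I J : choiceType} (y : {malg k[J]}) (x : {malg k[I]}) :=
  tens x y.

HB.instance Definition _ (I J : choiceType) (y : {malg k[J]}) :=
  GRing.isLinear.Build k {malg k[I]} {malg k[(I * J)%type]} *:%R (tensl y)
    (@tens_linearl k I J y).
HB.instance Definition _ (I J : choiceType) (x : {malg k[I]}) :=
  GRing.isLinear.Build k {malg k[J]} {malg k[(I * J)%type]} *:%R (tens x)
    (@tens_linearr k I J x).
HB.instance Definition _ (I J L : choiceType) :=
  GRing.Linear.copy (@tassoc k I J L) (lext _).
HB.instance Definition _ (I J I' J' : choiceType) :=
  GRing.Linear.copy (@tmid k I J I' J') (lext _).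
HB.instance Definition _ (I J : choiceType) (e : {malg k[J]} -> k) :=
  GRing.Linear.copy (@tformr k I J e) (lext _).
HB.instance Definition _ (I J : choiceType) (e : {malg k[I]} -> k) :=
  GRing.Linear.copy (@tforml k I J e) (lext _).
HB.instance Definition _ (I J : choiceType)
    (mu : {malg k[(J * J)%type]} -> {malg k[J]}) :=
  GRing.Linear.copy (@m1324 k I J mu) (tmap mu id \o tmid).

Lemma tassocU (I J L : choiceType) (i : I) (j : J) (l : L) :
  tassoc (basis ((i, j), l)) = basis (i, (j, l)) :> {malg k[_]}.
Proof. exact: lextU. Qed.

Lemma tmidU (I J I' J' : choiceType) (i : I) (j : J) (i' : I') (j' : J') :
  tmid (basis ((i, j), (i', j'))) = basis ((i, i'), (j, j')) :> {malg k[_]}.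
Proof. exact: lextU. Qed.

Lemma tformrU (I J : choiceType) (e : {malg k[J]} -> k) (i : I) j :
  tformr e (basis (i, j)) = e (basis j) *: basis i.
Proof. exact: lextU. Qed.

Lemma tformlU (I J : choiceType) (e : {malg k[I]} -> k) i (j : J) :
  tforml e (basis (i, j)) = e (basis i) *: basis j.
Proof. exact: lextU. Qed.

Lemma m1324U (I J : choiceType) (mu : {malg k[(J * J)%type]} -> {malg k[J]})
    (i i' : I) j j' :
  m1324 mu (basis ((j, i), (j', i'))) = tens (mu (basis (j, j'))) (basis (i, i')).
Proof. by rewrite /m1324 tmidU tmapU. Qed.

Lemma tens_sum (I J : choiceType) (S T : Type) (r : seq S) (s : seq T)
    (P : pred S) (Q : pred T) (x : S -> {malg k[I]}) (y : T -> {malg k[J]}) :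
  tens (\sum_(a <- r | P a) x a) (\sum_(b <- s | Q b) y b) =
  \sum_(a <- r | P a) \sum_(b <- s | Q b) tens (x a) (y b).
Proof.
rewrite -[LHS]/(tensl _ _) linear_sum; apply: eq_bigr => a _ /=.
by rewrite /tensl linear_sum.
Qed.

Lemma tmap_tens (I J I' J' : choiceType)
    (f : {linear {malg k[I]} -> {malg k[I']}})
    (g : {linear {malg k[J]} -> {malg k[J']}}) x y :
  tmap f g (tens x y) = tens (f x) (g y).
Proof.
apply: (@lin_ext _ _ _ (tmap f g \o tensl y) (tensl (g y) \o f)) => i /=.
rewrite /tensl.
apply: (@lin_ext _ _ _ (tmap f g \o tens (basis i)) (tens (f (basis i)) \o g)).
by move=> j /=; rewrite tensUU tmapU.
Qed.

Lemma tmap_comp (I J I' J' I'' J'' : choiceType)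
    (f : {linear {malg k[I']} -> {malg k[I'']}})
    (g : {linear {malg k[J']} -> {malg k[J'']}})
    (f' : {malg k[I]} -> {malg k[I']}) (g' : {malg k[J]} -> {malg k[J']}) x :
  tmap f g (tmap f' g' x) = tmap (f \o f') (g \o g') x.
Proof.
apply: (@lin_ext _ _ _ (tmap f g \o tmap f' g') (tmap (f \o f') (g \o g'))).
by move=> [i j] /=; rewrite !tmapU tmap_tens.
Qed.

Lemma eq_tmap (I J I' J' : choiceType) (f f' : {malg k[I]} -> {malg k[I']})
    (g g' : {malg k[J]} -> {malg k[J']}) :
  f =1 f' -> g =1 g' -> tmap f g =1 tmap f' g'.
Proof.
move=> ff' gg'; apply: lin_ext => -[i j].
by rewrite /= !tmapU ff' gg'.
Qed.

Lemma tassoc_tens (I J L : choiceType) (x : {malg k[I]}) (y : {malg k[J]})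
    (z : {malg k[L]}) :
  tassoc (tens (tens x y) z) = tens x (tens y z).
Proof.
apply: (@lin_ext _ _ _ (tassoc \o tensl z \o tensl y) (tensl (tens y z))) => i.
rewrite /= /tensl.
apply: (@lin_ext _ _ _ (tassoc \o tensl z \o tens (basis i))
  (tens (basis i) \o tensl z)) => j /=; rewrite /tensl tensUU.
apply: (@lin_ext _ _ _ (tassoc \o tens (basis (i, j)))
  (tens (basis i) \o tens (basis j))) => l /=.
by rewrite !tensUU tassocU.
Qed.

End TensorCalculus.

(** * Reindexing sums over subsets *)

Lemma sum_subsetU (M : nmodType) (T : finType) (S1 S2 : {set T})
    (F : {set T} -> M) : [disjoint S1 & S2] ->
  \sum_(A : {set T} | A \subset S1 :|: S2) F A =
  \sum_(B : {set T} | B \subset S1) \sum_(C : {set T} | C \subset S2) F (B :|: C).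
Proof.
move=> dS; rewrite pair_big.
rewrite (reindex_onto (fun p : {set T} * {set T} => p.1 :|: p.2)
  (fun A => (A :&: S1, A :&: S2))) => /= [|A sA]; last first.
  by rewrite -setIUr; apply/setIidPl.
apply: eq_bigl => -[B C] /=; rewrite xpair_eqE.
apply/idP/andP => [/and3P[_ /eqP <- /eqP <-]|[sB sC]].
  by rewrite !subsetIr.
rewrite setUSS //=; apply/andP; split; apply/eqP; rewrite setIUl.
  have /disjoint_setI0 -> : [disjoint C & S1].
    by apply: disjointWl sC _; rewrite disjoint_sym.
  by rewrite setU0; apply/setIidPl.
have /disjoint_setI0 -> : [disjoint B & S2] by apply: disjointWl sB dS.
by rewrite set0U; apply/setIidPl.
Qed.

(** The combinatorial core of coassociativity for both coproducts: a chain B in A in S is the same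
    as a set B together with the set C = A - B in its complement. *)
Lemma sum_subset_nested (M : nmodType) (T : finType) (S : {set T})
    (F : {set T} -> {set T} -> M) :
  \sum_(A : {set T} | A \subset S) \sum_(B : {set T} | B \subset A) F A B =
  \sum_(B : {set T} | B \subset S) \sum_(C : {set T} | C \subset S :\: B)
    F (B :|: C) B.
Proof.
rewrite !pair_big_dep.
rewrite (reindex_onto (fun p : {set T} * {set T} => (p.1 :|: p.2, p.1))
  (fun p => (p.2, p.1 :\: p.2))) => /= [|[A B] /andP[/= sA sB]]; last first.
  by congr (_, _); rewrite setUC setDE setUIl [~: B :|: B]setUC setUCr setIT;
    apply/setUidPl.
apply: eq_bigl => -[B C] /=; rewrite xpair_eqE eqxx /= subUset subsetUl andbT.
rewrite subsetD -andbA; congr (_ && (_ && _)).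
rewrite setDUl setDv set0U; apply/eqP/idP => [/setDidPl //|h].
by apply/setDidPl.
Qed.

(** * Separated parts of one hypergraph *)

Section Separated.
Variable G : hypergraph.
Implicit Types (P A : {set edge G}) (U Q R W : {set vertex G}).

(** Q1 and Q2 bound all the glued and kept vertices of the two parts, so one hypothesis serves every
    term of a sum. Vertices outside Q1 and Q2 are unconstrained: the two edge sets may meet there,
    which allows A and its complement in a connected hypergraph to be separated. *)
Definition separated P1 Q1 P2 Q2 :=
  [/\ [disjoint P1 & P2], [disjoint Q1 & Q2],
      forall e v, e \in P1 -> v \in inc e -> v \notin Q2 &
      forall e v, e \in P2 -> v \in inc e -> v \notin Q1].

Lemma cls_hunion_separated P1 Q1 P2 Q2 U1 U2 R1 R2 X Y :
  separated P1 Q1 P2 Q2 -> U1 \subset Q1 -> U2 \subset Q2 ->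
  R1 \subset Q1 -> R2 \subset Q2 ->
  cls X = cls (hsubq P1 U1 R1) -> cls Y = cls (hsubq P2 U2 R2) ->
  cls (hunion X Y) = cls (hsubq (P1 :|: P2) (U1 :|: U2) (R1 :|: R2)).
Proof.
case=> dP dQ h1 h2 sU1 sU2 sR1 sR2 /eqP/clsP hX /eqP/clsP hY.
have [t1 [q1 p1]] := hiso_presents (hsubq_presents _ _ _) hX.
have [t2 [q2 p2]] := hiso_presents (hsubq_presents _ _ _) hY.
apply: presents_cls; apply: hunion_presents p1 p2 dP _ _ _.
- by apply: disjointW dQ.
- move=> e v eP ve; apply: contra (h1 e v eP ve).
  by apply/subsetP; rewrite subUset sU2.
move=> e v eP ve; apply: contra (h2 e v eP ve).
by apply/subsetP; rewrite subUset sU1.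
Qed.

Lemma separatedS P1 Q1 P2 Q2 A1 A2 :
  A1 \subset P1 -> A2 \subset P2 ->
  separated P1 Q1 P2 Q2 -> separated A1 Q1 A2 Q2.
Proof.
move=> s1 s2 [dP dQ h1 h2]; split => //.
- exact: disjointW s1 s2 dP.
- by move=> e v /(subsetP s1); apply: h1.
by move=> e v /(subsetP s2); apply: h2.
Qed.

Lemma cls_hsubq_empty U : cls (hsubq set0 U set0) = cls hempty.
Proof.
apply/esym.
apply: (@presents_cls G set0 U set0 hempty (fun e : void => match e with end)
  (fun e : void => match e with end)).
by split; do [by move=> [] | by move=> x; rewrite inE].
Qed.

Lemma covered_rep_hsubq P U Q W : W \subset rstar P Q ->
  covered (rep (cls (hsubq P U W))).
Proof.
move=> sW; apply: covered_cls.
apply/coveredP => v; have /rstarP[_ [e eP ve]] := subsetP sW _ (valP v).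
exists (exist (fun C => C \in _) _ (imset_f (ecl P U) eP)).
by rewrite inE; apply/exists_inP; exists e => //; apply: ecl_id.
Qed.

End Separated.

(* The class c in the basis of H^d, meaningful only when c is covered. *)
Definition dclass_of (c : hclass) : dclass := insubd (dcls covered_hempty) c.

Lemma dclass_of_dcls X (cX : covered X) : dcls cX = dclass_of (cls X).
Proof. by apply: val_inj; rewrite val_insubd (covered_cls cX). Qed.

Lemma dclass_ofK c : covered (rep c) -> val (dclass_of c) = c.
Proof. by move=> h; rewrite val_insubd h. Qed.

Lemma valK_dclass (d : dclass) : dclass_of (val d) = d.
Proof. by apply: val_inj; rewrite dclass_ofK //; apply: (covered_drep d). Qed.

(** * The operations on basis elements *)

Section BasisValues.
Variable k : fieldType.

Lemma H_mulU c d :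
  H_mul k (basis (c, d)) = basis (cls (hunion (rep c) (rep d))).
Proof. exact: lextU. Qed.

Lemma H_DeltaU c :
  H_Delta k (basis c) =
  \sum_(F : {set edge (rep c)}) basis (cls (hrestr F), cls (hrestr (~: F))).
Proof. exact: lextU. Qed.

Lemma H_epsDeltaU c : H_epsDelta k (basis c) = (#|edge (rep c)| == 0%N)%:R.
Proof. exact: lextU. Qed.

Lemma H_deltaU c :
  H_delta k (basis c) =
  \sum_(U : {U : {set vertex (rep c)} | U \subset vstar (rep c)})
     basis (dclass_of (cls (htrace (val U))), cls (hquot (val U))).
Proof.
rewrite -[LHS]/(lext _ _) lextU.
by apply: eq_bigr => W _; rewrite dclass_of_dcls.
Qed.

Lemma Hd_mulU c d :
  Hd_mul k (basis (c, d)) = basis (dclass_of (cls (hunion (drep c) (drep d)))).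
Proof. by rewrite -[LHS]/(lext _ _) lextU dclass_of_dcls. Qed.

Lemma Hd_deltaU c :
  Hd_delta k (basis c) =
  \sum_(U : {U : {set vertex (drep c)} | U \subset vstar (drep c)})
     basis (dclass_of (cls (htrace (val U))), dclass_of (cls (hquot (val U)))).
Proof.
rewrite -[LHS]/(lext _ _) lextU.
by apply: eq_bigr => W _; rewrite !dclass_of_dcls.
Qed.

Lemma Hd_epsdeltaU c :
  Hd_epsdelta k (basis c) = (#|vertex (drep c)| == 0%N)%:R.
Proof. exact: lextU. Qed.

End BasisValues.

Section BasisFormulas.
Variables (k : fieldType) (G : hypergraph).
Implicit Types (P A : {set edge G}) (U Q W : {set vertex G}).

Lemma H_DeltaE P U Q :
  H_Delta k (basis (cls (hsubq P U Q))) =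
  \sum_(A : {set edge G} | saturated P U A)
     basis (cls (hsubq A U (ronly P Q A)),
            cls (hsubq (P :\: A) U (ronly P Q (P :\: A)))).
Proof.
rewrite H_DeltaU; have [t [q hX]] := rep_presents P U Q.
rewrite [RHS](eq_bigl (mem [set A | saturated P U A])) /=; last first.
  by move=> A; rewrite /= inE.
rewrite -(usum_imset hX) big_imset /=; last by move=> ? ? _ _; apply: (usum_inj hX).
apply: eq_big => [F|F _]; first by rewrite inE.
by rewrite (presents_cls (hrestr_presents hX F)) -(usum_compl hX)
  (presents_cls (hrestr_presents hX (~: F))).
Qed.

(** The summand f is left arbitrary so that the same reindexing serves the coaction on H and the
    coproduct on H^d, whose right factors lie in different bases. *)
Lemma sum_htrace_hquot (M : nmodType) (f : hclass -> hclass -> M) P U Q :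
  let X := rep (cls (hsubq P U Q)) in
  \sum_(Z : {Z : {set vertex X} | Z \subset vstar X})
     f (cls (htrace (val Z))) (cls (hquot (val Z))) =
  \sum_(W : {set vertex G} | W \subset rstar P Q)
     f (cls (hsubq P U W)) (cls (hsubq P (U :|: W) (Q :\: W))).
Proof.
move=> X; have [t [q hX]] := rep_presents P U Q.
rewrite -(@big_sub _ _ _ _ [pred Z : {set vertex X} | Z \subset vstar X]
  (fun Z => f (cls (htrace Z)) (cls (hquot Z)))) /=.
transitivity (\sum_(W in (fun V : {set vertex X} => q @: V) @:
    [set V : {set vertex X} | V \subset vstar X])
     f (cls (hsubq P U W)) (cls (hsubq P (U :|: W) (Q :\: W)))).
  rewrite big_imset /=; last by move=> ? ? _ _; apply/imset_inj/(pres_qI hX).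
  apply: eq_big => [Z|Z _]; first by rewrite !inE.
  by rewrite (presents_cls (htrace_presents hX Z))
    (presents_cls (hquot_presents hX Z)).
apply: eq_bigl => W; apply/imsetP/idP => [[V]|sW].
  by rewrite inE (vstar_presents hX) => ? ->.
(* W consists of vertices of Q, all of which are reached by q, so it is recovered from its
   preimage. *)
have WE : W = q @: (q @^-1: W).
  apply/setP => w; apply/idP/imsetP => [wW|[v]]; last by rewrite inE => ? ->.
  have /rstarP[wQ _] := subsetP sW _ wW.
  by have [v vw] := pres_qon hX wQ; exists v; rewrite ?inE ?vw.
by exists (q @^-1: W); rewrite ?inE ?(vstar_presents hX) -?WE.
Qed.

Lemma H_deltaE P U Q :
  H_delta k (basis (cls (hsubq P U Q))) =
  \sum_(W : {set vertex G} | W \subset rstar P Q)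
     basis (dclass_of (cls (hsubq P U W)), cls (hsubq P (U :|: W) (Q :\: W))).
Proof.
by rewrite H_deltaU -(sum_htrace_hquot (fun c d => basis (dclass_of c, d))).
Qed.

Lemma Hd_delta_basisE P U Q : covered (rep (cls (hsubq P U Q))) ->
  Hd_delta k (basis (dclass_of (cls (hsubq P U Q)))) =
  \sum_(W : {set vertex G} | W \subset rstar P Q)
     basis (dclass_of (cls (hsubq P U W)),
            dclass_of (cls (hsubq P (U :|: W) (Q :\: W)))).
Proof.
move=> cX; rewrite Hd_deltaU /drep (dclass_ofK cX).
by rewrite -(sum_htrace_hquot (fun c d => basis (dclass_of c, dclass_of d))).
Qed.

Lemma H_epsDeltaE P U Q :
  H_epsDelta k (basis (cls (hsubq P U Q))) = (P == set0)%:R :> k.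
Proof.
rewrite H_epsDeltaU; have [t [q hX]] := rep_presents P U Q; congr (_%:R).
congr nat_of_bool; apply/eqP/eqP => [/card0_eq e0|P0].
  apply/setP => e; rewrite inE; apply/negP => eP.
  by have [x _] := pres_ton hX eP; have := e0 x; rewrite inE.
apply: eq_card0 => x; have [e eP] := pres_tcl hX x.
by have := in_set0 e; rewrite -P0 eP.
Qed.

End BasisFormulas.

Lemma card_vertex_cls X : #|vertex (rep (cls X))| = #|vertex X|.
Proof. by case: (rep_cls X) => f [g [_ /bij_eq_card]]. Qed.

Lemma hiso_can X Y (f : edge X -> edge Y) f' (g : vertex X -> vertex Y) g' :
  cancel f f' -> cancel f' f -> cancel g g' -> cancel g' g ->
  (forall x v, (g v \in inc (f x)) = (v \in inc x)) -> hiso X Y.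
Proof.
move=> fK f'K gK g'K fg; exists f, g; split; [by exists f' | by exists g' |].
move=> x; apply/setP => v; rewrite -[v]g'K fg mem_imset //.
exact: can_inj gK.
Qed.

(** * Disjoint unions *)

Section HunionTheory.
Implicit Types X Y Z : hypergraph.

Lemma inc_hunion X Y (x : edge (hunion X Y)) (v : vertex (hunion X Y)) :
  (v \in inc x) = match x, v with
    | inl x, inl v => v \in inc x
    | inr y, inr w => w \in inc y
    | _, _ => false
  end.
Proof.
case: x v => [x|y] [v|w] /=.
- by rewrite mem_imset //; apply: inl_inj.
- by apply/imsetP => -[].
- by apply/imsetP => -[].
by rewrite mem_imset //; apply: inr_inj.
Qed.

Lemma hunion_hiso X Y X' Y' :
  hiso X X' -> hiso Y Y' -> hiso (hunion X Y) (hunion X' Y').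
Proof.
case=> [f1 [g1 [[f1' f1K f1'K] [g1' g1K g1'K] fg1]]].
case=> [f2 [g2 [[f2' f2K f2'K] [g2' g2K g2'K] fg2]]].
pose m A A' B B' (a : A -> A') (b : B -> B') (x : A + B) : A' + B' :=
  match x with inl x => inl (a x) | inr y => inr (b y) end.
apply: (@hiso_can _ _ (m _ _ _ _ f1 f2 : edge (hunion X Y) -> edge (hunion X' Y'))
  (m _ _ _ _ f1' f2')
  (m _ _ _ _ g1 g2 : vertex (hunion X Y) -> vertex (hunion X' Y'))
  (m _ _ _ _ g1' g2')).
- by case=> x /=; rewrite ?f1K ?f2K.
- by case=> x /=; rewrite ?f1'K ?f2'K.
- by case=> x /=; rewrite ?g1K ?g2K.
- by case=> x /=; rewrite ?g1'K ?g2'K.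
move=> [x|x] [v|v]; rewrite !inc_hunion //=.
  by rewrite fg1 mem_imset //; apply: can_inj g1K.
by rewrite fg2 mem_imset //; apply: can_inj g2K.
Qed.

Lemma hunion_cls X Y X' Y' :
  cls X = cls X' -> cls Y = cls Y' -> cls (hunion X Y) = cls (hunion X' Y').
Proof.
by move=> /eqP/clsP hX /eqP/clsP hY; apply/eqP/clsP/hunion_hiso.
Qed.

Lemma hunionA X Y Z :
  cls (hunion X (hunion Y Z)) = cls (hunion (hunion X Y) Z).
Proof.
pose a A B C (x : A + (B + C)) : (A + B) + C := match x with
  | inl x => inl (inl x) | inr (inl x) => inl (inr x) | inr (inr x) => inr x
  end.
pose b A B C (x : (A + B) + C) : A + (B + C) := match x with
  | inl (inl x) => inl x | inl (inr x) => inr (inl x) | inr x => inr (inr x)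
  end.
apply/eqP/clsP.
apply: (@hiso_can (hunion X (hunion Y Z)) (hunion (hunion X Y) Z)
  (a _ _ _) (b _ _ _) (a _ _ _) (b _ _ _)).
- by move=> [|[]].
- by move=> [[]|].
- by move=> [|[]].
- by move=> [[]|].
by move=> [x|[x|x]] [v|[v|v]]; rewrite !inc_hunion /a; lazy beta iota;
  rewrite ?inc_hunion.
Qed.

Lemma hunion0 X : cls (hunion hempty X) = cls X.
Proof.
apply/esym/eqP/clsP.
apply: (@hiso_can X (hunion hempty X) inr
  (fun x => match x with inl x => match x with end | inr x => x end) inr
  (fun x => match x with inl x => match x with end | inr x => x end)) => //.
- by case=> [[]|].
- by case=> [[]|].
by move=> x v; rewrite inc_hunion.
Qed.

Lemma hunion0r X : cls (hunion X hempty) = cls X.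
Proof.
apply/esym/eqP/clsP.
apply: (@hiso_can X (hunion X hempty) inl
  (fun x => match x with inr x => match x with end | inl x => x end) inl
  (fun x => match x with inr x => match x with end | inl x => x end)) => //.
- by case=> [|[]].
- by case=> [|[]].
by move=> x v; rewrite inc_hunion.
Qed.

Section Sides.
Variables X Y : hypergraph.

Definition ledges : {set edge (hunion X Y)} := inl @: [set: edge X].
Definition redges : {set edge (hunion X Y)} := inr @: [set: edge Y].
Definition lverts : {set vertex (hunion X Y)} := inl @: [set: vertex X].
Definition rverts : {set vertex (hunion X Y)} := inr @: [set: vertex Y].

Lemma mem_inl (A B : finType) (x : A + B) :
  (x \in inl @: [set: A]) = (if x is inl _ then true else false).
Proof. by case: x => x; [rewrite imset_f | apply/imsetP => -[]]. Qed.

Lemma mem_inr (A B : finType) (x : A + B) :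
  (x \in inr @: [set: B]) = (if x is inr _ then true else false).
Proof. by case: x => x; [apply/imsetP => -[] | rewrite imset_f]. Qed.

(** Makes a factor of a product a subquotient of the product, so that multiplicativity becomes a
    statement about two separated parts of one hypergraph. *)
Lemma cls_left : cls X = cls (hsubq ledges set0 lverts).
Proof.
apply: presents_cls; apply: (@embed_presents (hunion X Y) X inl inl).
- exact: inl_inj.
- exact: inl_inj.
by move=> x v; rewrite inc_hunion.
Qed.

Lemma cls_right : cls Y = cls (hsubq redges set0 rverts).
Proof.
apply: presents_cls; apply: (@embed_presents (hunion X Y) Y inr inr).
- exact: inr_inj.
- exact: inr_inj.
by move=> x v; rewrite inc_hunion.
Qed.

Lemma separated_sides : separated ledges lverts redges rverts.
Proof.
split.
- by apply/pred0P => -[] x /=; rewrite mem_inl mem_inr.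
- by apply/pred0P => -[] x /=; rewrite mem_inl mem_inr.
- by move=> [e|e] [v|v]; rewrite mem_inl mem_inr inc_hunion.
by move=> [e|e] [v|v]; rewrite mem_inl mem_inr inc_hunion.
Qed.

Lemma edges_sides : ledges :|: redges = setT.
Proof. by apply/setP => -[] x; rewrite inE mem_inl mem_inr inE. Qed.

Lemma verts_sides : lverts :|: rverts = setT.
Proof. by apply/setP => -[] x; rewrite inE mem_inl mem_inr inE. Qed.

End Sides.
End HunionTheory.

Arguments H_mul : simpl never.
Arguments H_Delta : simpl never.
Arguments H_epsDelta : simpl never.
Arguments H_delta : simpl never.
Arguments Hd_mul : simpl never.
Arguments Hd_Delta : simpl never.
Arguments Hd_epsDelta : simpl never.
Arguments Hd_delta : simpl never.
Arguments Hd_epsdelta : simpl never.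
Arguments Hd_incl : simpl never.

Lemma setUDU (T : finType) (S1 S2 A1 A2 : {set T}) :
  [disjoint S1 & S2] -> A1 \subset S1 -> A2 \subset S2 ->
  (S1 :|: S2) :\: (A1 :|: A2) = (S1 :\: A1) :|: (S2 :\: A2).
Proof.
move=> dS s1 s2; rewrite setDUl; congr (_ :|: _).
  rewrite -setDDl; apply/setDidPl; exact: disjointW (subsetDl _ _) s2 dS.
rewrite setUC -setDDl; apply/setDidPl.
by apply: disjointW (subsetDl _ _) s1 _; rewrite disjoint_sym.
Qed.

(** * Vertices relative to a set of edges *)

Section RelativeSets.
Variable G : hypergraph.
Implicit Types (P A B : {set edge G}) (U Q W : {set vertex G}).

Lemma ronly_ronly P Q A B : B \subset A -> A \subset P ->
  ronly A (ronly P Q A) B = ronly P Q B.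
Proof.
move=> sBA sAP; apply/setP => v.
apply/ronlyP/ronlyP => [[/ronlyP[vQ hA] hB]|[vQ hB]]; split => //.
- by move=> e eP ve; apply: (hB) => //; apply: hA.
- by apply/ronlyP; split=> // e eP ve; apply/(subsetP sBA)/hB.
by move=> e eA ve; apply: hB => //; apply: (subsetP sAP).
Qed.

Lemma ronly_setT P Q : ronly P Q P = Q.
Proof.
by apply/setP => v; apply/ronlyP/idP => [[]|vQ] //; split.
Qed.

Lemma ronlyD P Q U A : ronly P (Q :\: U) A = ronly P Q A :\: U.
Proof. by apply/setP => v; rewrite !inE -andbA. Qed.

Lemma rstar_sub P Q : rstar P Q \subset Q.
Proof. by apply/subsetP => v /rstarP[]. Qed.

Lemma rstar_id P Q W : W \subset rstar P Q -> rstar P W = W.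
Proof.
move=> sW; apply/setP => v; apply/rstarP/idP => [[]|vW] //.
by have /rstarP[_] := subsetP sW _ vW.
Qed.

Lemma rstarD P Q W : rstar P (Q :\: W) = rstar P Q :\: W.
Proof. by apply/setP => v; rewrite !inE -andbA. Qed.

Lemma ronly_sub P A Q : ronly P Q A \subset Q.
Proof. by apply/subsetP => v /ronlyP[]. Qed.

Lemma cls_hunion_set0 P1 Q1 P2 Q2 (R1 R2 : {set vertex G}) :
  separated P1 Q1 P2 Q2 -> R1 \subset Q1 -> R2 \subset Q2 ->
  cls (hunion (hsubq P1 set0 R1) (hsubq P2 set0 R2)) =
  cls (hsubq (P1 :|: P2) set0 (R1 :|: R2)).
Proof.
move=> s12 s1 s2; rewrite -[X in hsubq (_ :|: _) X](setU0 set0).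
by apply: (cls_hunion_separated s12); rewrite ?sub0set.
Qed.

End RelativeSets.

(** * The bialgebra (H, mu, Delta^d) *)

Section DeltaBialgebra.
Variable k : fieldType.

Lemma tens_suml (I J S : choiceType) (r : seq S) (P : pred S)
    (x : S -> {malg k[I]}) (y : {malg k[J]}) :
  tens (\sum_(a <- r | P a) x a) y = \sum_(a <- r | P a) tens (x a) y.
Proof. by rewrite -[LHS]/(tensl _ _) linear_sum. Qed.

(** Opens the computations on a single class: its own representative becomes the fixed ambient
    hypergraph whose subsets index all sums. *)
Lemma basis_self c :
  basis c = basis (cls (@hsubq (rep c) setT set0 setT)) :> {malg k[hclass]}.
Proof. by rewrite -cls_self repK. Qed.

Lemma H_Delta_set0 G (P : {set edge G}) Q :
  H_Delta k (basis (cls (hsubq P set0 Q))) =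
  \sum_(A : {set edge G} | A \subset P)
     basis (cls (hsubq A set0 (ronly P Q A)),
            cls (hsubq (P :\: A) set0 (ronly P Q (P :\: A)))).
Proof. by rewrite H_DeltaE; apply: eq_bigl => A; rewrite saturated0. Qed.

Lemma H_mulE X Y : H_mul k (basis (cls X, cls Y)) = basis (cls (hunion X Y)).
Proof.
rewrite H_mulU; congr basis; apply: hunion_cls; exact: repK.
Qed.

Lemma H_mulA x y z :
  H_mul k (tens x (H_mul k (tens y z))) = H_mul k (tens (H_mul k (tens x y)) z).
Proof.
have -> : tens x (H_mul k (tens y z)) =
    tmap idfun (H_mul k) (tassoc (tens (tens x y) z)).
  by rewrite tassoc_tens tmap_tens.
have -> : tens (H_mul k (tens x y)) z = tmap (H_mul k) idfun (tens (tens x y) z).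
  by rewrite tmap_tens.
apply: (@lin_ext _ _ _ (H_mul k \o tmap idfun (H_mul k) \o tassoc)
  (H_mul k \o tmap (H_mul k) idfun)) => -[[a b] c] /=.
rewrite tassocU !tmapU /= -[a]repK -[b]repK -[c]repK !H_mulE !tensUU !H_mulE.
by rewrite hunionA.
Qed.

Lemma H_mul1 x : H_mul k (tens (H_one k) x) = x.
Proof.
apply: (@lin_ext _ _ _ (H_mul k \o tens (H_one k)) idfun) => c /=.
by rewrite tensUU -[c]repK H_mulE hunion0.
Qed.

Lemma H_mulr1 x : H_mul k (tens x (H_one k)) = x.
Proof.
apply: (@lin_ext _ _ _ (H_mul k \o tensl (H_one k)) idfun) => c /=.
by rewrite /tensl tensUU -[c]repK H_mulE hunion0r.
Qed.

Lemma H_DeltaA x :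
  tassoc (tmap (H_Delta k) id (H_Delta k x)) =
  tmap id (H_Delta k) (H_Delta k x).
Proof.
apply: (@lin_ext _ _ _ (tassoc \o tmap (H_Delta k) id \o H_Delta k)
  (tmap id (H_Delta k) \o H_Delta k)) => c /=.
rewrite basis_self H_Delta_set0 !linear_sum /=.
(* A chain B in A encodes the splitting of the edges into B, A - B and the complement of A. The left
   side chooses A and then B; the right side chooses B and then A - B. *)
pose F (A B : {set edge (rep c)}) : {malg k[(hclass * (hclass * hclass))%type]} :=
  basis (cls (hsubq B set0 (ronly setT setT B)),
    (cls (hsubq (A :\: B) set0 (ronly setT setT (A :\: B))),
     cls (hsubq (setT :\: A) set0 (ronly setT setT (setT :\: A))))).
transitivity (\sum_(A : {set edge (rep c)} | A \subset setT)
    \sum_(B : {set edge (rep c)} | B \subset A) F A B).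
  apply: eq_bigr => A sA; rewrite tmapU H_Delta_set0 tens_suml linear_sum /=.
  apply: eq_bigr => B sB; rewrite tensUU tassocU.
  by rewrite !ronly_ronly ?subsetDl.
rewrite sum_subset_nested; apply: eq_bigr => B sB.
rewrite tmapU H_Delta_set0 linear_sum /=.
apply: eq_bigr => C sC; rewrite tensUU /F setDUl setDv set0U.
have /setDidPl -> : [disjoint C & B] by move: sC; rewrite subsetD => /andP[].
by rewrite -setDDl !ronly_ronly ?subsetDl.
Qed.

Lemma H_Delta_counitl x : tforml (H_epsDelta k) (H_Delta k x) = x.
Proof.
apply: (@lin_ext _ _ _ (tforml (H_epsDelta k) \o H_Delta k) idfun) => c /=.
rewrite basis_self H_Delta_set0 linear_sum /=.
rewrite (bigD1 set0) ?sub0set //= big1 => [|A /andP[_ A0]].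
  by rewrite addr0 tformlU H_epsDeltaE eqxx scale1r setD0 ronly_setT.
by rewrite tformlU H_epsDeltaE (negPf A0) scale0r.
Qed.

Lemma H_Delta_counitr x : tformr (H_epsDelta k) (H_Delta k x) = x.
Proof.
apply: (@lin_ext _ _ _ (tformr (H_epsDelta k) \o H_Delta k) idfun) => c /=.
rewrite basis_self H_Delta_set0 linear_sum /=.
rewrite (bigD1 setT) ?subxx //= big1 => [|A /andP[_ AT]].
  by rewrite addr0 tformrU H_epsDeltaE setDv eqxx scale1r ronly_setT.
by rewrite tformrU H_epsDeltaE setD_eq0 subTset (negPf AT) scale0r.
Qed.

Lemma ronlyU G (P1 P2 A1 A2 : {set edge G}) (Q1 Q2 : {set vertex G}) :
  separated P1 Q1 P2 Q2 -> A1 \subset P1 -> A2 \subset P2 ->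
  ronly (P1 :|: P2) (Q1 :|: Q2) (A1 :|: A2) = ronly P1 Q1 A1 :|: ronly P2 Q2 A2.
Proof.
case=> dP dQ h1 h2 s1 s2; apply/setP => v; rewrite [RHS]inE.
apply/ronlyP/orP => [[/setUP[vQ|vQ] hA]|[]/ronlyP[vQ hA]].
- left; apply/ronlyP; split=> // e eP ve.
  have /setUP[//|/(subsetP s2) eP2] : e \in A1 :|: A2.
    by apply: hA => //; rewrite inE eP.
  by have := disjointFr dP eP; rewrite eP2.
- right; apply/ronlyP; split=> // e eP ve.
  have /setUP[/(subsetP s1) eP1|//] : e \in A1 :|: A2.
    by apply: hA => //; rewrite inE eP orbT.
  by have := disjointFl dP eP; rewrite eP1.
- split; first by rewrite inE vQ.
  move=> e /setUP[eP ve|eP ve]; first by rewrite inE hA.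
  by have := h2 e v eP ve; rewrite vQ.
split; first by rewrite inE vQ orbT.
move=> e /setUP[eP ve|eP ve]; last by rewrite inE hA ?orbT.
by have := h1 e v eP ve; rewrite vQ.
Qed.

(** A subset of P1 ∪ P2 is a pair of subsets, and without cross incidence its set of retained
    vertices is the union of those on each side, so the terms match one by one. *)
Lemma H_Delta_separated G (P1 P2 : {set edge G}) (Q1 Q2 : {set vertex G}) :
  separated P1 Q1 P2 Q2 ->
  H_Delta k (basis (cls (hsubq (P1 :|: P2) set0 (Q1 :|: Q2)))) =
  tmap (H_mul k) (H_mul k) (tmid
    (tens (H_Delta k (basis (cls (hsubq P1 set0 Q1))))
          (H_Delta k (basis (cls (hsubq P2 set0 Q2)))))).
Proof.
move=> sep; have [dP _ _ _] := sep.
rewrite !H_Delta_set0 tens_sum !linear_sum /= sum_subsetU //.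
apply: eq_bigr => A1 s1; rewrite !linear_sum /=; apply: eq_bigr => A2 s2.
rewrite tensUU tmidU tmapU !H_mulE tensUU setUDU // !ronlyU ?subsetDl //.
rewrite (cls_hunion_set0 (separatedS s1 s2 sep)) ?ronly_sub //.
by rewrite (cls_hunion_set0 (separatedS (subsetDl _ A1) (subsetDl _ A2) sep))
  ?ronly_sub.
Qed.

Lemma H_DeltaM x y :
  H_Delta k (H_mul k (tens x y)) =
  tmap (H_mul k) (H_mul k) (tmid (tens (H_Delta k x) (H_Delta k y))).
Proof.
rewrite -tmap_tens; move: (tens x y) => {x y}.
apply: (@lin_ext _ _ _ (H_Delta k \o H_mul k)
  (tmap (H_mul k) (H_mul k) \o tmid \o tmap (H_Delta k) (H_Delta k))).
move=> [c d] /=; rewrite tmapU -[c]repK -[d]repK H_mulE.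
set X := rep c; set Y := rep d.
rewrite cls_self -edges_sides -verts_sides (cls_left X Y) (cls_right X Y).
exact: H_Delta_separated (separated_sides X Y).
Qed.

Lemma H_Delta1 : H_Delta k (H_one k) = tens (H_one k) (H_one k).
Proof.
have eqE (A B : {set void}) : A = B by apply/setP => -[].
rewrite tensUU /H_one -{1}(@cls_hsubq_empty hempty set0) H_Delta_set0.
rewrite (big_pred1 set0) => [|A]; last first.
  by rewrite (eqE A set0) sub0set /= eqxx.
by rewrite setD0 ronly_setT cls_hsubq_empty.
Qed.

Lemma bilin_ext (I J : choiceType) (f : {linear {malg k[(I * J)%type]} -> k^o})
    (e : {linear {malg k[I]} -> k^o}) (e' : {linear {malg k[J]} -> k^o}) :
  (forall i j, f (basis (i, j)) = (e (basis i) : k) * (e' (basis j) : k)) ->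
  forall x y, f (tens x y) = (e x : k) * (e' y : k).
Proof.
(* Scaling acts on the left, so the factor kept fixed is brought to the front for each variable in
   turn. *)
move=> h x y; rewrite mulrC.
apply: (@lin_ext _ _ _ (f \o tensl y) ( *:%R (e' y : k) \o e)) => i /=.
rewrite /tensl /GRing.scale /= mulrC.
apply: (@lin_ext _ _ _ (f \o tens (basis i)) ( *:%R (e (basis i) : k) \o e')).
by move=> j /=; rewrite tensUU; apply: h.
Qed.

Lemma H_epsDeltaM x y :
  H_epsDelta k (H_mul k (tens x y)) =
  (H_epsDelta k x : k) * (H_epsDelta k y : k).
Proof.
apply: (@bilin_ext _ _ (H_epsDelta k \o H_mul k)) => c d /=.
rewrite -[c]repK -[d]repK H_mulE.
set X := rep c; set Y := rep d.
rewrite cls_self -edges_sides -verts_sides (cls_left X Y) (cls_right X Y).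
by rewrite !H_epsDeltaE setU_eq0 -natrM mulnb.
Qed.

Lemma H_epsDelta1 : H_epsDelta k (H_one k) = 1 :> k.
Proof.
by rewrite /H_one -(@cls_hsubq_empty hempty set0) H_epsDeltaE eqxx.
Qed.

Lemma H_is_bialgebra : is_bialgebra (H_bialgebra k).
Proof.
split; [exact: H_mulA | exact: H_mul1 | exact: H_mulr1 | exact: H_DeltaA
  | exact: H_Delta_counitl | exact: H_Delta_counitr | exact: H_DeltaM
  | exact: H_Delta1 | exact: H_epsDeltaM | exact: H_epsDelta1].
Qed.
End DeltaBialgebra.

Lemma rstarU G (P1 P2 : {set edge G}) (Q1 Q2 : {set vertex G}) :
  separated P1 Q1 P2 Q2 ->
  rstar (P1 :|: P2) (Q1 :|: Q2) = rstar P1 Q1 :|: rstar P2 Q2.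
Proof.
case=> _ _ h1 h2; apply/setP => v; rewrite [RHS]inE.
apply/rstarP/orP => [[vQ [e /setUP[]eP ve]]|[]/rstarP[vQ [e eP ve]]].
- left; apply/rstarP; split; last by exists e.
  by move: vQ; rewrite inE (negPf (h1 _ _ eP ve)) orbF.
- right; apply/rstarP; split; last by exists e.
  by move: vQ; rewrite inE (negPf (h2 _ _ eP ve)).
- by split; [rewrite inE vQ | exists e; rewrite // inE eP].
by split; [rewrite inE vQ orbT | exists e; rewrite // inE eP orbT].
Qed.

(** A vertex on no edge of A glues nothing in A. This lets a factor glued along its own vertices
    only be rewritten as glued along a larger set shared with the other factor. *)
Lemma cls_hsubq_absorb G (A : {set edge G}) (U W Q : {set vertex G}) :
  [disjoint Q & W] -> (forall e v, e \in A -> v \in inc e -> v \notin W) ->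
  cls (hsubq A U (Q :\: U)) = cls (hsubq A (U :|: W) (Q :\: (U :|: W))).
Proof.
move=> dQW hA; rewrite [U :|: W]setUC -setDDl.
have /setDidPl -> := dQW.
apply: eq_cls_hsubq => // e e' eA _; apply/hshareP/hshareP => -[v [vU ve ve']].
  by exists v; rewrite inE vU orbT.
exists v; split => //; move: vU; rewrite inE (negPf (hA e v eA ve)).
by [].
Qed.

(** * The coaction delta^d *)

Section Coaction.
Variable k : fieldType.

(** Scaling seen as linear in the scalar, so that a map of the form e(x) v is a composite of linear
    maps and can be tested on a basis. *)
Definition scalel {V : lmodType k} (v : V) (a : k^o) : V := (a : k) *: v.

Lemma scalel_is_linear (V : lmodType k) (v : V) : linear (scalel v).
Proof. by move=> a x y; rewrite /scalel scalerDl scalerA. Qed.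

HB.instance Definition _ (V : lmodType k) (v : V) :=
  GRing.isLinear.Build k k^o V *:%R (scalel v) (scalel_is_linear v).

Lemma H_delta_set0 G (P : {set edge G}) Q :
  H_delta k (basis (cls (hsubq P set0 Q))) =
  \sum_(W : {set vertex G} | W \subset rstar P Q)
     basis (dclass_of (cls (hsubq P set0 W)), cls (hsubq P W (Q :\: W))).
Proof. by rewrite H_deltaE; apply: eq_bigr => W _; rewrite set0U. Qed.

(** Every vertex of W lies on an edge of P, so the condition on Z reduces to inclusion in W. *)
Lemma Hd_delta_set0 G (P : {set edge G}) (Q W : {set vertex G}) : W \subset rstar P Q ->
  Hd_delta k (basis (dclass_of (cls (hsubq P set0 W)))) =
  \sum_(Z : {set vertex G} | Z \subset W)
     basis (dclass_of (cls (hsubq P set0 Z)),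
            dclass_of (cls (hsubq P Z (W :\: Z)))).
Proof.
move=> sW; rewrite Hd_delta_basisE; last exact: covered_rep_hsubq sW.
by rewrite (rstar_id sW); apply: eq_bigr => Z _; rewrite set0U.
Qed.

Lemma Hd_epsdelta_hsubq G (P : {set edge G}) (U W : {set vertex G}) :
  covered (rep (cls (hsubq P U W))) ->
  Hd_epsdelta k (basis (dclass_of (cls (hsubq P U W)))) = (W == set0)%:R :> k.
Proof.
move=> cW; rewrite Hd_epsdeltaU /drep (dclass_ofK cW) card_vertex_cls /=.
by rewrite card_sig cards_eq0.
Qed.

Lemma Hd_mul_cls X Y : covered (rep (cls X)) -> covered (rep (cls Y)) ->
  Hd_mul k (basis (dclass_of (cls X), dclass_of (cls Y))) =
  basis (dclass_of (cls (hunion X Y))).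
Proof.
move=> cX cY; rewrite Hd_mulU /drep !dclass_ofK //; congr (basis (dclass_of _)).
by apply: hunion_cls; apply: repK.
Qed.

Lemma H_delta_coact x :
  tassoc (tmap (Hd_delta k) id (H_delta k x)) =
  tmap id (H_delta k) (H_delta k x).
Proof.
apply: (@lin_ext _ _ _ (tassoc \o tmap (Hd_delta k) id \o H_delta k)
  (tmap id (H_delta k) \o H_delta k)) => c /=.
rewrite basis_self H_delta_set0 !linear_sum /=.
set P := [set: edge (rep c)]; set Q := [set: vertex (rep c)].
(* The common term is indexed by a chain W in U: the trace on W, the part between W and U, and the
   quotient by U. Quotients do not change which vertices lie on an edge, so both sides range over
   the same chains. *)
pose F (U W : {set vertex (rep c)}) : {malg k[(dclass * (dclass * hclass))%type]} :=
  basis (dclass_of (cls (hsubq P set0 W)),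
    (dclass_of (cls (hsubq P W (U :\: W))), cls (hsubq P U (Q :\: U)))).
transitivity (\sum_(U : {set vertex (rep c)} | U \subset rstar P Q)
    \sum_(W : {set vertex (rep c)} | W \subset U) F U W).
  apply: eq_bigr => U sU; rewrite tmapU (Hd_delta_set0 sU) tens_suml linear_sum /=.
  by apply: eq_bigr => W sW; rewrite tensUU tassocU.
rewrite sum_subset_nested; apply: eq_bigr => W sW.
rewrite tmapU H_deltaE linear_sum rstarD /=.
apply: eq_bigr => Z sZ; rewrite tensUU /F setDUl setDv set0U.
have /setDidPl -> : [disjoint Z & W] by move: sZ; rewrite subsetD => /andP[].
by rewrite -setDDl.
Qed.

Lemma H_delta_counitl x : tforml (Hd_epsdelta k) (H_delta k x) = x.
Proof.
apply: (@lin_ext _ _ _ (tforml (Hd_epsdelta k) \o H_delta k) idfun) => c /=.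
rewrite basis_self H_delta_set0 linear_sum /=.
rewrite (bigD1 set0) ?sub0set //= big1 => [|W /andP[sW W0]]; rewrite tformlU.
  rewrite addr0 Hd_epsdelta_hsubq ?eqxx ?scale1r ?setD0 //.
  exact: (@covered_rep_hsubq _ _ _ setT _ (sub0set _)).
rewrite Hd_epsdelta_hsubq ?(negPf W0) ?scale0r //.
exact: covered_rep_hsubq sW.
Qed.

Lemma Hd_one_cls : Hd_one k = basis (dclass_of (cls hempty)).
Proof. by rewrite -(dclass_of_dcls covered_hempty). Qed.

(** A quotient of E is empty only if E is. In that case no vertex lies on an edge, so U is empty and
    the left factor is the unit, whatever isolated vertices are present. *)
Lemma H_delta_epsDelta x :
  tformr (H_epsDelta k) (H_delta k x) = (H_epsDelta k x : k) *: Hd_one k.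
Proof.
apply: (@lin_ext _ _ _ (tformr (H_epsDelta k) \o H_delta k)
  (scalel (Hd_one k) \o H_epsDelta k)) => c /=.
rewrite /scalel basis_self H_delta_set0 H_epsDeltaE linear_sum /=.
under eq_bigr => W _ do rewrite tformrU H_epsDeltaE.
case: eqP => [P0|_]; last by rewrite big1 ?scale0r // => W _; rewrite scale0r.
have r0 : rstar [set: edge (rep c)] setT = set0.
  by apply/setP => v; rewrite in_set0; apply/rstarP => -[_ [e]]; rewrite P0 inE.
rewrite r0 (big_pred1 set0) => [|W]; last by rewrite subset0.
by rewrite P0 cls_hsubq_empty Hd_one_cls.
Qed.

Lemma H_delta1 : H_delta k (H_one k) = tens (Hd_one k) (H_one k).
Proof.
have eqE (A B : {set void}) : A = B by apply/setP => -[].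
rewrite Hd_one_cls tensUU /H_one -{1}(@cls_hsubq_empty hempty set0) H_delta_set0.
rewrite (big_pred1 set0) => [|A]; last first.
  by rewrite (eqE A set0) sub0set /= eqxx.
by rewrite setD0 cls_hsubq_empty.
Qed.

Lemma H_delta_separated G (P1 P2 : {set edge G}) (Q1 Q2 : {set vertex G}) :
  separated P1 Q1 P2 Q2 ->
  H_delta k (basis (cls (hsubq (P1 :|: P2) set0 (Q1 :|: Q2)))) =
  tmap id (H_mul k) (m1324 (Hd_mul k)
    (tens (H_delta k (basis (cls (hsubq P1 set0 Q1))))
          (H_delta k (basis (cls (hsubq P2 set0 Q2)))))).
Proof.
move=> sep; have [_ dQ _ _] := sep.
rewrite !H_delta_set0 (rstarU sep) tens_sum !linear_sum /= sum_subsetU; last first.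
  exact: disjointW (rstar_sub _ _) (rstar_sub _ _) dQ.
apply: eq_bigr => W1 s1; rewrite !linear_sum /=; apply: eq_bigr => W2 s2.
rewrite tensUU m1324U Hd_mul_cls; [|exact: covered_rep_hsubq s1
  |exact: covered_rep_hsubq s2].
rewrite tensUU tmapU H_mulE tensUU.
have q1 := subset_trans s1 (rstar_sub _ _).
have q2 := subset_trans s2 (rstar_sub _ _).
rewrite setUDU // (cls_hunion_set0 sep) //.
by rewrite (cls_hunion_separated sep _ _ _ _ erefl erefl) ?subsetDl.
Qed.

Lemma H_deltaM t :
  H_delta k (H_mul k t) =
  tmap id (H_mul k) (m1324 (Hd_mul k) (tmap (H_delta k) (H_delta k) t)).
Proof.
apply: (@lin_ext _ _ _ (H_delta k \o H_mul k)
  (tmap idfun (H_mul k) \o m1324 (Hd_mul k) \o tmap (H_delta k) (H_delta k))).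
move=> [c d] /=; rewrite tmapU -[c]repK -[d]repK H_mulE.
set X := rep c; set Y := rep d.
rewrite cls_self -edges_sides -verts_sides (cls_left X Y) (cls_right X Y).
exact: H_delta_separated (separated_sides X Y).
Qed.

Lemma H_delta_Delta x :
  tmap id (H_Delta k) (H_delta k x) =
  m1324 (Hd_mul k) (tmap (H_delta k) (H_delta k) (H_Delta k x)).
Proof.
apply: (@lin_ext _ _ _ (tmap idfun (H_Delta k) \o H_delta k)
  (m1324 (Hd_mul k) \o tmap (H_delta k) (H_delta k) \o H_Delta k)) => c /=.
rewrite basis_self H_delta_set0 H_Delta_set0 !linear_sum /=.
set P := [set: edge (rep c)]; set Q := [set: vertex (rep c)].
pose F (A : {set edge (rep c)}) (U : {set vertex (rep c)}) :
    {malg k[(dclass * (hclass * hclass))%type]} :=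
  basis (dclass_of (cls (hsubq P set0 U)),
    (cls (hsubq A U (ronly P Q A :\: U)),
     cls (hsubq (P :\: A) U (ronly P Q (P :\: A) :\: U)))).
transitivity (\sum_(U : {set vertex (rep c)} | U \subset rstar P Q)
    \sum_(A : {set edge (rep c)} | saturated P U A) F A U).
  apply: eq_bigr => U sU; rewrite tmapU H_DeltaE linear_sum /=.
  by apply: eq_bigr => A sA; rewrite tensUU !ronlyD.
(* The right side fixes A before the glued vertices, so the sum over A is moved outside. *)
rewrite (exchange_big_dep (fun A : {set edge (rep c)} => A \subset P)) /=; last first.
  by move=> U A _ /saturatedP[].
apply: eq_bigr => A sA; pose B := P :\: A.
pose R1 := rstar A (ronly P Q A); pose R2 := rstar B (ronly P Q B).
have sep : separated A R1 B R2.
  have dAB : [disjoint A & B].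
    by rewrite disjoint_sym; apply/pred0P => e; rewrite /= !inE andbAC andNb.
  have hA e v : e \in A -> v \in inc e -> v \notin R2.
    move=> eA ve; apply/negP => /rstarP[/ronlyP[_ /(_ e)]].
    by move=> /(_ (in_setT e) ve) eB; have := disjointFr dAB eA; rewrite eB.
  have hB e v : e \in B -> v \in inc e -> v \notin R1.
    move=> eB ve; apply/negP => /rstarP[/ronlyP[_ /(_ e)]].
    by move=> /(_ (in_setT e) ve) eA; have := disjointFr dAB eA; rewrite eB.
  split => //; apply/pred0P => v /=; apply/negP => /andP[/rstarP[_ [e eA ve]]].
  by apply/negP/(hA e).
have AB : A :|: B = P by rewrite /B setUC setDE setUIl setUC [~: _ :|: _]setUC
   setUCr setIT; apply/setUidPr.
(* Saturation says that the edges at a given vertex of U lie all in A or all in B, which places the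
   vertex in R1 or R2. *)
have UE (U : {set vertex (rep c)}) : (U \subset rstar P Q) && saturated P U A = (U \subset R1 :|: R2).
  apply/andP/idP => [[sU /saturatedP[_ cA]]|sU].
    apply/subsetP => v vU; have /rstarP[_ [e _ ve]] := subsetP sU v vU.
    have eA e' : v \in inc e' -> (e' \in A) = (e \in A).
      move=> ve'; apply/esym/cA; rewrite /adj !in_setT /=.
      by apply/hshareP; exists v.
    rewrite inE; case eA': (e \in A) in eA; apply/orP; [left|right].
      apply/rstarP; split; last by exists e.
      by apply/ronlyP; split=> // e' _ /eA.
    apply/rstarP; split; last by exists e; rewrite // !inE eA'.
    by apply/ronlyP; split=> // e' _ /eA; rewrite !inE => ->.
  split.
    apply/subsetP => v /(subsetP sU); rewrite inE => /orP[]/rstarP[_ [e _ ve]];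
      by apply/rstarP; split=> //; exists e.
  apply/saturatedP; split => // e e' /and3P[_ _ /hshareP[v [/(subsetP sU) + ve ve']]].
  case/setUP=> /rstarP[/ronlyP[_ hv] _].
    by rewrite /= !hv.
  have := hv e' (in_setT _) ve'; have := hv e (in_setT _) ve.
  by rewrite !inE !andbT => /negPf /= -> /negPf ->.
rewrite (eq_bigl _ _ UE) sum_subsetU; last by case: sep.
rewrite tmapU !H_delta_set0 tens_sum linear_sum /=.
apply: eq_bigr => U1 s1; rewrite linear_sum /=; apply: eq_bigr => U2 s2.
rewrite tensUU m1324U Hd_mul_cls; [|exact: covered_rep_hsubq s1
  |exact: covered_rep_hsubq s2].
rewrite tensUU (cls_hunion_set0 sep) // AB.
have [dAB _ hA hB] := sep.
(* The factor on A is glued along U1 on one side and along U1 ∪ U2 on the other. A vertex of U2 lies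
   on an edge of B and on no edge of A, so it is neither kept nor glued in that factor;
   symmetrically for B. *)
have dA : [disjoint ronly P Q A & U2].
  apply/pred0P => v /=; apply/negP => /andP[/ronlyP[_ vA]].
  move=> /(subsetP s2)/rstarP[_ [e eB ve]].
  by have := disjointFr dAB (vA e (in_setT _) ve); rewrite eB.
have dB : [disjoint ronly P Q B & U1].
  apply/pred0P => v /=; apply/negP => /andP[/ronlyP[_ vB]].
  move=> /(subsetP s1)/rstarP[_ [e eA ve]].
  by have := disjointFl dAB (vB e (in_setT _) ve); rewrite eA.
have iA e v : e \in A -> v \in inc e -> v \notin U2.
  by move=> eA ve; apply: contra (hA e v eA ve); apply: (subsetP s2).
have iB e v : e \in B -> v \in inc e -> v \notin U1.
  by move=> eB ve; apply: contra (hB e v eB ve); apply: (subsetP s1).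
by rewrite (cls_hsubq_absorb _ dA iA) (cls_hsubq_absorb _ dB iB) [U2 :|: U1]setUC.
Qed.
End Coaction.

(** * Naturality of the tensor operations *)

Section Naturality.
Variable k : fieldType.

Lemma tmap_id (I J : choiceType) :
  tmap id id =1 @id {malg k[(I * J)%type]}.
Proof. by apply: (@lin_ext _ _ _ _ idfun) => -[i j] /=; rewrite tmapU tensUU. Qed.

Lemma tmap_inj (I J I' J' : choiceType)
    (f : {linear {malg k[I]} -> {malg k[I']}})
    (g : {linear {malg k[J]} -> {malg k[J']}})
    (f' : {linear {malg k[I']} -> {malg k[I]}})
    (g' : {linear {malg k[J']} -> {malg k[J]}}) :
  cancel f f' -> cancel g g' -> cancel (tmap f g) (tmap f' g').
Proof. by move=> fK gK x; rewrite tmap_comp (eq_tmap fK gK) tmap_id. Qed.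

Lemma tmap_square (I J I1 J1 I2 J2 I' J' : choiceType)
    (f : {linear {malg k[I1]} -> {malg k[I']}})
    (g : {linear {malg k[J1]} -> {malg k[J']}})
    (a : {malg k[I]} -> {malg k[I1]}) (b : {malg k[J]} -> {malg k[J1]})
    (a' : {linear {malg k[I2]} -> {malg k[I']}})
    (b' : {linear {malg k[J2]} -> {malg k[J']}})
    (f' : {malg k[I]} -> {malg k[I2]}) (g' : {malg k[J]} -> {malg k[J2]}) t :
  f \o a =1 a' \o f' -> g \o b =1 b' \o g' ->
  tmap f g (tmap a b t) = tmap a' b' (tmap f' g' t).
Proof. by move=> fa gb; rewrite !tmap_comp (eq_tmap fa gb). Qed.

Lemma tmap_tassoc (I J L I' J' L' : choiceType)
    (f : {malg k[I]} -> {malg k[I']}) (g : {malg k[J]} -> {malg k[J']})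
    (h : {malg k[L]} -> {malg k[L']}) t :
  tmap f (tmap g h) (tassoc t) = tassoc (tmap (tmap f g) h t).
Proof.
apply: (@lin_ext _ _ _ (tmap f (tmap g h) \o tassoc)
  (tassoc \o tmap (tmap f g) h)) => -[[i j] l] /=.
by rewrite tassocU !tmapU tassoc_tens.
Qed.

Lemma tforml_tmap (I J I' J' : choiceType) (e : {linear {malg k[I]} -> k^o})
    (e' : {linear {malg k[I']} -> k^o}) (f : {malg k[I]} -> {malg k[I']})
    (g : {linear {malg k[J]} -> {malg k[J']}}) t :
  (forall x, e x = e' (f x)) -> g (tforml e t) = tforml e' (tmap f g t).
Proof.
move=> ee'.
have tT (x : {malg k[I']}) (y : {malg k[J']}) :
    tforml e' (tens x y) = (e' x : k) *: y.
  apply: (@lin_ext _ _ _ (tforml e' \o tens x) ( *:%R (e' x : k))) => j /=.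
  apply: (@lin_ext _ _ _ (tforml e' \o tensl (basis j)) (scalel (basis j) \o e')).
  by move=> i /=; rewrite /tensl tensUU tformlU.
apply: (@lin_ext _ _ _ (g \o tforml e) (tforml e' \o tmap f g)) => -[i j] /=.
by rewrite tformlU tmapU linearZ tT ee'.
Qed.

Lemma tformr_tmap (I J I' J' : choiceType) (e : {linear {malg k[J]} -> k^o})
    (e' : {linear {malg k[J']} -> k^o}) (f : {linear {malg k[I]} -> {malg k[I']}})
    (g : {malg k[J]} -> {malg k[J']}) t :
  (forall x, e x = e' (g x)) -> f (tformr e t) = tformr e' (tmap f g t).
Proof.
move=> ee'.
have tT (x : {malg k[I']}) (y : {malg k[J']}) :
    tformr e' (tens x y) = (e' y : k) *: x.
  apply: (@lin_ext _ _ _ (tformr e' \o tensl y) ( *:%R (e' y : k))) => i /=.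
  rewrite /tensl.
  apply: (@lin_ext _ _ _ (tformr e' \o tens (basis i)) (scalel (basis i) \o e')).
  by move=> j /=; rewrite tensUU tformrU.
apply: (@lin_ext _ _ _ (f \o tformr e) (tformr e' \o tmap f g)) => -[i j] /=.
by rewrite tformrU tmapU linearZ tT ee'.
Qed.

Lemma tmid_tens (I J I' J' : choiceType) (x : {malg k[I]}) (y : {malg k[J]})
    (x' : {malg k[I']}) (y' : {malg k[J']}) :
  tmid (tens (tens x y) (tens x' y')) = tens (tens x x') (tens y y').
Proof.
apply: (@lin_ext _ _ _ (tmid \o tensl (tens x' y') \o tensl y)
  (tensl (tens y y') \o tensl x')) => i; rewrite /= /tensl.
apply: (@lin_ext _ _ _ (tmid \o tensl (tens x' y') \o tens (basis i))
  (tens (tens (basis i) x') \o tensl y')) => j; rewrite /= /tensl tensUU.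
apply: (@lin_ext _ _ _ (tmid \o tens (basis (i, j)) \o tensl y')
  (tensl (tens (basis j) y') \o tens (basis i))) => i'; rewrite /= /tensl tensUU.
apply: (@lin_ext _ _ _ (tmid \o tens (basis (i, j)) \o tens (basis i'))
  (tens (basis (i, i')) \o tens (basis j))) => j' /=.
by rewrite !tensUU tmidU.
Qed.

Lemma tmap_tmid (I J I' J' K L K' L' : choiceType)
    (f : {malg k[I]} -> {malg k[K]}) (g : {malg k[J]} -> {malg k[L]})
    (f' : {malg k[I']} -> {malg k[K']}) (g' : {malg k[J']} -> {malg k[L']}) t :
  tmap (tmap f f') (tmap g g') (tmid t) = tmid (tmap (tmap f g) (tmap f' g') t).
Proof.
apply: (@lin_ext _ _ _ (tmap (tmap f f') (tmap g g') \o tmid)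
  (tmid \o tmap (tmap f g) (tmap f' g'))) => -[[i j] [i' j']] /=.
by rewrite tmidU !tmapU tmid_tens.
Qed.

Lemma tmap_id_square (L J J1 J2 J' : choiceType)
    (g : {linear {malg k[J1]} -> {malg k[J']}})
    (b : {malg k[J]} -> {malg k[J1]})
    (b' : {linear {malg k[J2]} -> {malg k[J']}})
    (g' : {malg k[J]} -> {malg k[J2]}) (t : {malg k[(L * J)%type]}) :
  g \o b =1 b' \o g' ->
  tmap id g (tmap id b t) = tmap id b' (tmap id g' t).
Proof. exact: (@tmap_square _ _ _ _ _ _ _ _ idfun g id b idfun b' id g'). Qed.

Lemma tmap_m1324 (I J L : choiceType)
    (mu : {linear {malg k[(J * J)%type]} -> {malg k[J]}})
    (f : {malg k[I]} -> {malg k[L]}) t :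
  tmap id (tmap f f) (m1324 mu t) = m1324 mu (tmap (tmap id f) (tmap id f) t).
Proof.
rewrite /m1324 -tmap_tmid.
apply: (@tmap_square _ _ _ _ _ _ _ _ idfun (tmap f f) mu id mu idfun) => // y.
by rewrite /= tmap_id.
Qed.

End Naturality.

(** * Restriction to H^d *)

Section Restriction.
Variable k : fieldType.
Local Notation i := (Hd_incl k).
Local Notation Mul := (H_mul k).
Local Notation mul := (Hd_mul k).
Local Notation cop := (Hd_Delta k).
Local Notation cac := (Hd_delta k).

(** An explicit left inverse of the inclusion passes to tensor products by functoriality, and so
    gives injectivity of the tensor powers of the inclusion. Classes with isolated vertices are sent
    by default to the unit. *)
Definition Hd_retr : {linear {malg k[hclass]} -> {malg k[dclass]}} :=
  lext (fun c => basis (dclass_of c)).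

Lemma Hd_inclK : cancel i Hd_retr.
Proof.
apply: (@lin_ext _ _ _ (Hd_retr \o i) idfun) => d /=.
by rewrite -[i _]/(lext _ _) lextU -[Hd_retr _]/(lext _ _) lextU valK_dclass.
Qed.

(** In the names of these injections each digit is a tensor factor: 1 where it is included in H, 0
    where it stays in H^d. *)
Let inj1 : injective i := can_inj Hd_inclK.

Lemma idfunK (I : choiceType) :
  cancel (idfun : {linear {malg k[I]} -> _}) (idfun : {linear {malg k[I]} -> _}).
Proof. by []. Qed.

Let inj11 : injective (tmap i i) := can_inj (tmap_inj Hd_inclK Hd_inclK).
Let inj01 : injective (tmap id i : {malg k[(dclass * dclass)%type]} -> _) :=
  can_inj (tmap_inj (@idfunK _) Hd_inclK).
Let inj111 : injective (tmap i (tmap i i)) :=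
  can_inj (tmap_inj Hd_inclK (tmap_inj Hd_inclK Hd_inclK)).
Let inj001 : injective (tmap id (tmap id i) :
    {malg k[(dclass * (dclass * dclass))%type]} -> _) :=
  can_inj (tmap_inj (@idfunK _) (tmap_inj (@idfunK _) Hd_inclK)).
Let inj011 : injective (tmap id (tmap i i) :
    {malg k[(dclass * (dclass * dclass))%type]} -> _) :=
  can_inj (tmap_inj (@idfunK _) (tmap_inj Hd_inclK Hd_inclK)).

Lemma Hd_mul_tens x y : i (mul (tens x y)) = Mul (tens (i x) (i y)).
Proof. by rewrite Hd_mulE tmap_tens. Qed.

Lemma Hd_mulA x y z : mul (tens x (mul (tens y z))) = mul (tens (mul (tens x y)) z).
Proof. by apply: inj1; rewrite !Hd_mul_tens H_mulA. Qed.

Lemma Hd_mul1 x : mul (tens (Hd_one k) x) = x.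
Proof. by apply: inj1; rewrite Hd_mul_tens Hd_oneE H_mul1. Qed.

Lemma Hd_mulr1 x : mul (tens x (Hd_one k)) = x.
Proof. by apply: inj1; rewrite Hd_mul_tens Hd_oneE H_mulr1. Qed.

Lemma Hd_Delta_is_bialgebra :
  is_bialgebra (BialgebraData mul (Hd_one k) cop (Hd_epsDelta k)).
Proof.
split=> /=; [exact: Hd_mulA | exact: Hd_mul1 | exact: Hd_mulr1 |..].
- move=> x; apply: inj111; rewrite tmap_tassoc.
  rewrite (@tmap_square _ _ _ _ _ _ _ _ _ _ _ _ _ (H_Delta k) idfun i i) //;
    last exact: Hd_DeltaE.
  rewrite (@tmap_square _ _ _ _ _ _ _ _ _ _ _ _ _ idfun (H_Delta k) i i) //;
    last exact: Hd_DeltaE.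
  by rewrite !Hd_DeltaE H_DeltaA.
- move=> x; apply: inj1; rewrite (@tforml_tmap _ _ _ _ _ _ (H_epsDelta k) i).
    by rewrite Hd_DeltaE H_Delta_counitl.
  exact: Hd_epsDeltaE.
- move=> x; apply: inj1; rewrite (@tformr_tmap _ _ _ _ _ _ (H_epsDelta k) i i).
    by rewrite Hd_DeltaE H_Delta_counitr.
  exact: Hd_epsDeltaE.
- move=> x y; apply: inj11; rewrite Hd_DeltaE Hd_mul_tens H_DeltaM.
  rewrite (@tmap_square _ _ _ _ _ _ _ _ _ _ _ _ _ Mul Mul (tmap i i) (tmap i i));
    try exact: Hd_mulE.
  by rewrite tmap_tmid tmap_tens /= !Hd_DeltaE.
- by apply: inj11; rewrite Hd_DeltaE tmap_tens Hd_oneE H_Delta1.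
- by move=> x y; rewrite !Hd_epsDeltaE Hd_mul_tens H_epsDeltaM.
by rewrite Hd_epsDeltaE Hd_oneE H_epsDelta1.
Qed.

(** Only the last factor is included in H, because the coaction on H already has its left factor in
    H^d. *)
Lemma Hd_deltaA x :
  tassoc (tmap cac id (cac x)) = tmap id cac (cac x).
Proof.
apply: inj001; rewrite tmap_tassoc.
have -> : tmap (tmap id id) i (tmap cac id (cac x)) =
    tmap cac idfun (tmap id i (cac x)).
  by apply: tmap_square => // y /=; rewrite tmap_id.
rewrite (tmap_id_square (b' := H_delta k) (g' := i)); last exact: Hd_deltaE.
by rewrite !Hd_deltaE H_delta_coact.
Qed.

Lemma Hd_delta_counitl x : tforml (Hd_epsdelta k) (cac x) = x.
Proof.
apply: inj1; rewrite (@tforml_tmap _ _ _ _ _ _ (Hd_epsdelta k) idfun) //.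
by rewrite Hd_deltaE H_delta_counitl.
Qed.

(** The counit on the right keeps only the term where U is all of V, and this term occurs because V
    = V^*. On H it would be missing for a hypergraph with isolated vertices, hence a direct
    computation instead of a restriction. *)
Lemma Hd_delta_counitr x : tformr (Hd_epsdelta k) (cac x) = x.
Proof.
apply: (@lin_ext _ _ _ (tformr (Hd_epsdelta k) \o cac) idfun) => d /=.
pose P := [set: edge (drep d)]; pose Q := [set: vertex (drep d)].
have -> : basis d = basis (dclass_of (cls (hsubq P set0 Q))) :> {malg k[dclass]}.
  by rewrite -cls_self repK valK_dclass.
have sQ : rstar P Q = setT.
  apply/setP => v; rewrite in_setT; apply/rstarP; split=> //.
  by have /coveredP/(_ v)[e ve] := covered_drep d; exists e.
rewrite (@Hd_delta_set0 k _ _ Q) ?sQ //.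
rewrite linear_sum /= (bigD1 setT) //= big1 => [|W /andP[_ WT]]; rewrite tformrU.
  rewrite addr0 setDv Hd_epsdelta_hsubq ?eqxx ?scale1r //.
  exact: (@covered_rep_hsubq _ _ _ Q _ (sub0set _)).
rewrite Hd_epsdelta_hsubq ?setD_eq0 ?subTset ?(negPf WT) ?scale0r //.
by apply: (@covered_rep_hsubq _ _ _ Q); rewrite sQ.
Qed.

Lemma Hd_deltaM t : cac (mul t) = tmap id mul (m1324 mul (tmap cac cac t)).
Proof.
apply: inj01; rewrite Hd_deltaE Hd_mulE H_deltaM.
rewrite (tmap_id_square (b' := Mul) (g' := tmap i i)); last exact: Hd_mulE.
rewrite tmap_m1324; congr (tmap _ _ (m1324 _ _)).
by apply: tmap_square => y /=; rewrite Hd_deltaE.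
Qed.

(** The form is given on H^d alone, so it is computed there: the vertex counts add up, and a sum of
    naturals vanishes only if both terms do. *)
Lemma Hd_epsdeltaM x y :
  Hd_epsdelta k (mul (tens x y)) = (Hd_epsdelta k x : k) * (Hd_epsdelta k y : k).
Proof.
apply: (@bilin_ext _ _ _ (Hd_epsdelta k \o mul)) => c d /=.
rewrite Hd_mulU !Hd_epsdeltaU /drep dclass_ofK; last first.
  by apply: covered_cls; apply: covered_hunion; apply: covered_drep.
by rewrite card_vertex_cls card_sum addn_eq0 -natrM mulnb.
Qed.

Lemma Hd_delta1 : cac (Hd_one k) = tens (Hd_one k) (Hd_one k).
Proof. by apply: inj01; rewrite Hd_deltaE (tmap_tens idfun) Hd_oneE H_delta1. Qed.

Lemma Hd_epsdelta1 : Hd_epsdelta k (Hd_one k) = 1 :> k.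
Proof. by rewrite Hd_epsdeltaU card_vertex_cls card_void. Qed.

Lemma Hd_delta_is_bialgebra : is_bialgebra (Hd_bialgebra k).
Proof.
split=> /=; [exact: Hd_mulA | exact: Hd_mul1 | exact: Hd_mulr1 | exact: Hd_deltaA
  | exact: Hd_delta_counitl | exact: Hd_delta_counitr | | exact: Hd_delta1
  | exact: Hd_epsdeltaM | exact: Hd_epsdelta1].
by move=> x y; rewrite Hd_deltaM /m1324 tmap_tens (tmap_comp idfun).
Qed.

Lemma H_comodule_bialgebra :
  is_comodule_bialgebra (H_bialgebra k) (Hd_bialgebra k) (H_delta k).
Proof.
split; [exact: H_is_bialgebra | exact: Hd_delta_is_bialgebra
  | exact: H_delta_coact | exact: H_delta_counitl | exact: H_delta_epsDelta
  | exact: H_delta_Delta | exact: H_delta1 | exact: H_deltaM].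
Qed.

Lemma Hd_delta_epsDelta x :
  tformr (Hd_epsDelta k) (cac x) = (Hd_epsDelta k x : k) *: Hd_one k.
Proof.
rewrite -[LHS]/(idfun _) (@tformr_tmap _ _ _ _ _ _ (H_epsDelta k) idfun i).
  by rewrite Hd_deltaE H_delta_epsDelta Hd_epsDeltaE.
exact: Hd_epsDeltaE.
Qed.

Lemma Hd_delta_Delta x :
  tmap id cop (cac x) = m1324 mul (tmap cac cac (cop x)).
Proof.
apply: inj011.
rewrite (tmap_id_square (b' := H_Delta k) (g' := i)); last exact: Hd_DeltaE.
rewrite Hd_deltaE H_delta_Delta -Hd_DeltaE tmap_m1324; congr (m1324 _ _).
by apply: tmap_square => y /=; rewrite Hd_deltaE.
Qed.

End Restriction.

Theorem proposition4p8 (k : fieldType) :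
  is_comodule_bialgebra (H_bialgebra k) (Hd_bialgebra k) (H_delta k) /\
  is_double_bialgebra (Hd_mul k) (Hd_one k)
    (Hd_Delta k) (Hd_epsDelta k) (Hd_delta k) (Hd_epsdelta k).
Proof.
split; first exact: H_comodule_bialgebra.
split; [exact: Hd_Delta_is_bialgebra | exact: Hd_delta_is_bialgebra |].
split; [exact: Hd_Delta_is_bialgebra | exact: Hd_delta_is_bialgebra
  | exact: Hd_deltaA | exact: Hd_delta_counitl | exact: Hd_delta_epsDelta
  | exact: Hd_delta_Delta | exact: Hd_delta1 | exact: Hd_deltaM].
Qed.
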